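(* Let $S$ be a non-elementary, irreducible and aperiodic rational graph-directed Markov system (rational GDMS). Suppose that the associated skew product map $\tilde f$ is expanding along fibers. Then $\tilde f$ is topologically exact on $J(\tilde f)$; that is, for each open subset $U$ of $X(S)\times\widehat{\mathbb C}$ with $U\cap J(\tilde f)\ne\emptyset$ there exists $N\in\mathbb N$ such that $\tilde f^n(U)\supset J(\tilde f)$ for every $n\ge N$.
   Context: $\widehat{\mathbb C}$ is the Riemann sphere with spherical distance $d_{\widehat{\mathbb C}}$; $\mathrm{Rat}$ is the set of non-constant rational maps on $\widehat{\mathbb C}$; $\mathbb N=\{1,2,\dots\}$. A rational GDMS is a triple $S=(V,E,(\Gamma_e)_{e\in E})$ where $(V,E)$ is a directed graph with finite vertex set $V$ and finite edge set $E$, and each $\Gamma_e\subset\mathrm{Rat}$ is non-empty and finite. $i(e)$, $t(e)$ denote the initial and terminal vertices of $e\in E$. $X(S)=\{\xi=(g_n,e_n)_{n\in\mathbb N}\in(\mathrm{Rat}\times E)^{\mathbb N} : g_n\in\Gamma_{e_n},\ t(e_n)=i(e_{n+1})\ \forall n\}$, with left shift $\sigma$ and the usual shift metric $d_X$; it is a subshift of finite type over the finite alphabet $\{(g,e): e\in E, g\in\Gamma_e\}$. Write $\xi=(g_{\xi,n},e_{\xi,n})_{n}$. $X(S)\times\widehat{\mathbb C}$ has the product (sum) metric. $S$ is irreducible and aperiodic if $(X(S),\sigma)$ is irreducible and aperiodic (i.e. some power of its transition matrix has all entries positive). $X^N(S)$ is the set of subwords of length $N$ of elements of $X(S)$; for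 $\xi=(g_n,e_n)_{1\le n\le N}\in X^N(S)$, $g_\xi=g_N\circ\cdots\circ g_1$. For $i\in V$, $H_i(S)=\bigcup_{N\in\mathbb N}\{g_\xi:\xi\in X^N(S),\ i(e_1)=i\}$; $F_i(S)$ is the set of $z\in\widehat{\mathbb C}$ such that $H_i(S)$ is equicontinuous on some neighborhood of $z$; $J_i(S)=\widehat{\mathbb C}\setminus F_i(S)$. $S$ is non-elementary if $\#J_i(S)\ge3$ for all $i\in V$. The skew product map is $\tilde f(\xi,z)=(\sigma(\xi),g_{\xi,1}(z))$ on $X(S)\times\widehat{\mathbb C}$. For $\xi\in X(S)$, $F_\xi$ is the set of $z$ such that $(g_{\xi,N}\circ\cdots\circ g_{\xi,1})_{N\in\mathbb N}$ is equicontinuous on some neighborhood of $z$, and $J_\xi=\widehat{\mathbb C}\setminus F_\xi$. The skew product Julia set is $J(\tilde f)=\overline{\bigcup_{\xi\in X(S)}\{\xi\}\times J_\xi}\subset X(S)\times\widehat{\mathbb C}$. For $\tilde z=(\xi,z)$, $(\tilde f^n)'(\tilde z)=(g_{\xi,n}\circ\cdots\circ g_{\xi,1})'(z)$, and $\|\cdot\|$ denotes the norm of the derivative with respect to the spherical metric. $\tilde f$ is expanding along fibers if there exist $C>0$ and $\lambda>1$ such that $\inf_{\tilde z\in J(\tilde f)}\|(\tilde f^n)'(\tilde z)\|\ge C\lambda^n$ for each $n\in\mathbb N$. *)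

(* Defs.v *)
From HB Require Import structures.
From mathcomp Require Import all_boot all_order all_algebra finmap.
From mathcomp Require Import all_classical all_reals all_analysis.
From mathcomp Require Import complex.
From mathcomp Require Import ring lra.

Set Implicit Arguments.
Unset Strict Implicit.
Unset Printing Implicit Defensive.

Import Order.TTheory GRing.Theory Num.Theory.
Import numFieldNormedType.Exports.

Local Open Scope classical_set_scope.
Local Open Scope ring_scope.
Local Open Scope complex_scope.

(* [None] is the point at infinity. *)
Definition Chat (R : realType) : Type := option R[i].

Section RiemannSphere.
Context {R : realType}.
Implicit Types p q r : Chat R.

Definition sqnormc (z : R[i]) : R := complex.Re z ^+ 2 + complex.Im z ^+ 2.

(* Inverse stereographic projection onto the unit sphere of R^3. *)
Definition stereo p : R * R * R :=
  if p is Some z then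
    (complex.Re z *+ 2 / (1 + sqnormc z), complex.Im z *+ 2 / (1 + sqnormc z),
     (sqnormc z - 1) / (1 + sqnormc z))
  else (0, 0, 1).

Definition dot3 (u v : R * R * R) : R :=
  u.1.1 * v.1.1 + u.1.2 * v.1.2 + u.2 * v.2.

(* Length of the great-circle arc, i.e. the geodesic distance of the metric
   2|dz| / (1 + |z|^2). *)
Definition sph_dist p q : R := acos (dot3 (stereo p) (stereo q)).

Let den_neq0 (z : R[i]) : 1 + sqnormc z != 0.
Proof. by rewrite gt_eqF// ltr_pwDl// addr_ge0// sqr_ge0. Qed.

Lemma stereo_unit p : dot3 (stereo p) (stereo p) = 1.
Proof.
case: p => [z|]; last by rewrite /dot3/=; ring.
have := den_neq0 z; rewrite /dot3 /=; set s := sqnormc z => s0.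
have -> : s - 1 = (1 + s) - 2 by ring.
have E : s = complex.Re z ^+ 2 + complex.Im z ^+ 2 by [].
have -> : complex.Re z *+ 2 / (1 + s) * (complex.Re z *+ 2 / (1 + s))
   + complex.Im z *+ 2 / (1 + s) * (complex.Im z *+ 2 / (1 + s))
   = 4 * s / (1 + s) ^+ 2 by rewrite {5}E; field.
by field.
Qed.

Lemma stereo_inj : injective stereo.
Proof.
have sN (z : R[i]) : (sqnormc z - 1) / (1 + sqnormc z) != 1.
  rewrite -subr_eq0; have z0 := den_neq0 z.
  have -> : (sqnormc z - 1) / (1 + sqnormc z) - 1 = - 2 / (1 + sqnormc z).
    by field.
  by rewrite mulf_neq0 ?invr_eq0// oppr_eq0 pnatr_eq0.
case=> [z|] [w|] //=; last 2 first.
- by case=> _ _ /eqP; rewrite (negbTE (sN z)).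
- by case=> _ _ /esym/eqP; rewrite (negbTE (sN w)).
have z0 := den_neq0 z; have w0 := den_neq0 w.
case=> hr hi hs.
have s_eq : sqnormc z = sqnormc w.
  have : (1 - (sqnormc z - 1) / (1 + sqnormc z)) ^-1 =
         (1 - (sqnormc w - 1) / (1 + sqnormc w)) ^-1 by rewrite hs.
  have aux (s : R) : 1 + s != 0 -> (1 - (s - 1) / (1 + s))^-1 = (1 + s) / 2.
    move=> s0; have -> : 1 - (s - 1) / (1 + s) = 2 / (1 + s) by field.
    by rewrite invf_div.
  rewrite !aux// => h; lra.
move: hr hi; rewrite s_eq => /(mulIf (invr_neq0 w0)) hr.
move=> /(mulIf (invr_neq0 w0)) hi; congr Some; apply/eqP.
rewrite eq_complex; apply/andP; split; apply/eqP; lra.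
Qed.

Lemma dot3C u v : dot3 u v = dot3 v u.
Proof. by rewrite /dot3; ring. Qed.

Lemma dot_stereo_itv p q : -1 <= dot3 (stereo p) (stereo q) <= 1.
Proof.
have hp := stereo_unit p; have hq := stereo_unit q; move: hp hq.
case: (stereo p) (stereo q) => [[a b] c] [[x y] z]; rewrite /dot3/= => hp hq.
have := sqr_ge0 (a - x); have := sqr_ge0 (b - y); have := sqr_ge0 (c - z).
have := sqr_ge0 (a + x); have := sqr_ge0 (b + y); have := sqr_ge0 (c + z).
by move=> *; apply/andP; split; nra.
Qed.

Lemma sph_distxx p : sph_dist p p = 0.
Proof. by rewrite /sph_dist stereo_unit acos1. Qed.

Lemma sph_dist_sym p q : sph_dist p q = sph_dist q p.
Proof. by rewrite /sph_dist dot3C. Qed.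

Lemma sph_dist_positivity p q : sph_dist p q = 0 -> p = q.
Proof.
rewrite /sph_dist => h; apply: stereo_inj.
have : dot3 (stereo p) (stereo q) = 1.
  by rewrite -[LHS]acosK ?h ?cos0// in_itv/= dot_stereo_itv.
have hp := stereo_unit p; have hq := stereo_unit q; move: hp hq.
case: (stereo p) (stereo q) => [[a b] c] [[x y] z]; rewrite /dot3/= => hp hq hh.
have s0 : (a - x) ^+ 2 + (b - y) ^+ 2 + (c - z) ^+ 2 = 0.
  transitivity ((a * a + b * b + c * c) + (x * x + y * y + z * z)
    - (a * x + b * y + c * z) *+ 2); first by ring.
  by rewrite hp hq hh; ring.
have /eqP := s0; rewrite !paddr_eq0 ?addr_ge0 ?sqr_ge0//.
rewrite !sqrf_eq0 !subr_eq0.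
by move=> /andP[/andP[/eqP-> /eqP->] /eqP->].
Qed.

Lemma sph_dist_triangle q p r : sph_dist p r <= sph_dist p q + sph_dist q r.
Proof.
have gram : (dot3 (stereo p) (stereo q) * dot3 (stereo q) (stereo r)
      - dot3 (stereo p) (stereo r)) ^+ 2 <=
    (1 - dot3 (stereo p) (stereo q) ^+ 2) *
    (1 - dot3 (stereo q) (stereo r) ^+ 2).
  have hp := stereo_unit p; have hq := stereo_unit q; have hr := stereo_unit r.
  move: hp hq hr.
  case: (stereo p) (stereo q) (stereo r) => [[a b] c] [[x y] z] [[u v] w].
  rewrite /dot3/= => hp hq hr; rewrite -subr_ge0.
  have := sqr_ge0 (a * (y * w - z * v) - b * (x * w - z * u)
    + c * (x * v - y * u)).
  congr (_ <= _).
  set A := a * x + b * y + c * z; set B := x * u + y * v + z * w.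
  set C := a * u + b * v + c * w.
  transitivity ((a * a + b * b + c * c) * (x * x + y * y + z * z)
     * (u * u + v * v + w * w) + (A * B * C) *+ 2
     - (a * a + b * b + c * c) * B ^+ 2 - (x * x + y * y + z * z) * C ^+ 2
     - (u * u + v * v + w * w) * A ^+ 2); first by rewrite /A /B /C; ring.
  by rewrite hp hq hr; ring.
rewrite /sph_dist.
have := dot_stereo_itv p q; have := dot_stereo_itv q r.
have := dot_stereo_itv p r; move: gram.
move: (dot3 (stereo p) (stereo q)) (dot3 (stereo q) (stereo r))
  (dot3 (stereo p) (stereo r)) => a b c gram hc hb ha.
have [hpi|hpi] := leP pi (acos a + acos b).
  by apply: le_trans hpi; exact: acos_lepi.
have hs : 0 <= acos a + acos b by rewrite addr_ge0 ?acos_ge0.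
have key : cos (acos a + acos b) <= c.
  rewrite cosD !acosK ?in_itv//= !sin_acos// -sqrtrM ?subr_ge0 ?sqr_le1//; last nra.
  rewrite lerBlDr -lerBlDl; apply: le_trans (ler_norm _) _.
  by rewrite -sqrtr_sqr ler_wsqrtr.
rewrite leNgt; apply/negP => lt_s; move: key; apply/negP; rewrite -ltNge.
rewrite -[X in X < _]acosK ?in_itv//= ltr_cos// in_itv/=.
- by rewrite hs ltW.
- by rewrite acos_ge0// acos_lepi.
Qed.

HB.instance Definition _ := Choice.on (Chat R).
HB.instance Definition _ := isPointed.Build (Chat R) None.
HB.instance Definition _ := @isMetric.Build R (Chat R) sph_dist
  sph_distxx sph_dist_positivity sph_dist_sym sph_dist_triangle.

End RiemannSphere.

Section RationalMaps.
Context {R : realType}.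
Implicit Types (p q : Chat R) (P Q : {poly R[i]}) (g : Chat R -> Chat R).

(* The map z |-> P(z) / Q(z), for coprime P and Q.  Its value at infinity is
   read off the coefficients of degree max(deg P, deg Q). *)
Definition fraction_map P Q p : Chat R :=
  if p is Some z then
    if Q.[z] == 0 then None else Some (P.[z] / Q.[z])
  else
    let d := (maxn (size P) (size Q)).-1 in
    if Q`_d == 0 then None else Some (P`_d / Q`_d).

Definition Rat : set (Chat R -> Chat R) :=
  [set g | (exists P Q, coprimep P Q /\ g = fraction_map P Q) /\
           (forall c, g <> cst c)].

(* Holomorphic chart around [p]: w |-> w when [p] is finite, w |-> 1 / w when
   [p] is infinity.  The value of [chart p] at the point outside its domain is
   irrelevant. *)
Definition chart p q : R[i] :=
  match p, q with
  | Some _, Some w => w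
  | None, Some w => w^-1
  | _, None => 0
  end.

Definition chart_inv p (w : R[i]) : Chat R :=
  if p is Some _ then Some w else if w == 0 then None else Some w^-1.

(* The spherical metric is 2|dw| / (1 + |w|^2) in both charts, so the norm of
   g'(p) is |h'(w)| (1 + |w|^2) / (1 + |h(w)|^2), where h is the expression of g
   in the charts around p and g(p), and w is the coordinate of p. *)
Definition sph_deriv_norm g p : R :=
  let h : R[i]^o -> R[i]^o := fun w => chart (g p) (g (chart_inv p w)) in
  let w := chart p p in
  Normc.normc (derive1 h w) * (1 + sqnormc w) / (1 + sqnormc (h w)).

Definition equicontinuous_near (G : set (Chat R -> Chat R)) p : Prop :=
  exists2 U, nbhs p U &
    equicontinuous G (fun g => g : subspace U -> Chat R).

End RationalMaps.

Record rationalGDMS (R : realType) := RationalGDMS {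
  vertex : finType;
  edge : finType;
  source : edge -> vertex;
  target : edge -> vertex;
  maps : edge -> {fset (Chat R -> Chat R)};
  maps_neq0 : forall e, maps e != fset0;
  maps_Rat : forall e g, g \in maps e -> Rat g
}.

Section RationalGDMS.
Context {R : realType} (S : rationalGDMS R).

(* The finite alphabet of pairs (g, e) with g in Gamma_e. *)
Definition letter : finType := {e : edge S & maps e}.

Definition ledge (a : letter) : edge S := tag a.
Definition lmap (a : letter) : Chat R -> Chat R := fsval (tagged a).

Definition admissible (a b : letter) : bool :=
  target (ledge a) == source (ledge b).

Definition transition_matrix : 'M[int]_#|letter| :=
  \matrix_(i, j) (admissible (enum_val i) (enum_val j))%:R.

Definition irreducible_aperiodic : Prop :=
  exists N : nat, (0 < N)%N /\
    forall i j, 0 < (transition_matrix ^+ N) i j.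

(* Sequences are indexed from 0.  The topology induced by the shift metric is
   the product topology for the discrete topology on the alphabet. *)
Definition shift_seqs : set {ptws nat -> discrete_topology letter} :=
  [set xi | forall n, admissible (xi n) (xi n.+1)].

(* X(S), with the subspace topology. *)
Definition shift_space : Type := set_type shift_seqs.

HB.instance Definition _ := Topological.on shift_space.

Definition letter_at (xi : shift_space) (n : nat) : letter := set_val xi n.

Lemma shift_subproof (xi : shift_space) :
  (fun n => letter_at xi n.+1) \in shift_seqs.
Proof. by apply/mem_set => n; exact: (set_mem (valP xi)). Qed.

Definition shift (xi : shift_space) : shift_space :=
  @exist _ (fun x => x \in shift_seqs) _ (shift_subproof xi).

(* [:: a_1; ...; a_N] |-> g_N \o ... \o g_1 *)
Definition word_map (w : seq letter) : Chat R -> Chat R :=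
  foldl (fun h a => lmap a \o h) id w.

(* X^N(S) *)
Definition words (N : nat) : set (N.-tuple letter) :=
  [set w | exists (xi : shift_space) (m : nat),
             forall k : 'I_N, tnth w k = letter_at xi (m + k)].

(* H_i(S); the length N.+1 ranges over the positive integers. *)
Definition vertex_maps (i : vertex S) : set (Chat R -> Chat R) :=
  [set h | exists N (w : N.+1.-tuple letter),
     [/\ words w, source (ledge (thead w)) = i & h = word_map w]].

Definition vertex_Fatou (i : vertex S) : set (Chat R) :=
  [set z | equicontinuous_near (vertex_maps i) z].

Definition vertex_Julia (i : vertex S) : set (Chat R) := ~` vertex_Fatou i.

Definition non_elementary : Prop :=
  forall i, (`I_3 #<= vertex_Julia i)%card.

(* g_{xi,n} \o ... \o g_{xi,1} *)
Definition fiber_map (xi : shift_space) (n : nat) : Chat R -> Chat R :=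
  word_map (mkseq (letter_at xi) n).

Definition skew_product (z : shift_space * Chat R) : shift_space * Chat R :=
  (shift z.1, lmap (letter_at z.1 0) z.2).

Definition fiber_Fatou (xi : shift_space) : set (Chat R) :=
  [set z | equicontinuous_near [set fiber_map xi n | n in [set n | (0 < n)%N]] z].

Definition fiber_Julia (xi : shift_space) : set (Chat R) := ~` fiber_Fatou xi.

Definition skew_Julia : set (shift_space * Chat R) :=
  closure (\bigcup_xi ([set xi] `*` fiber_Julia xi)).

Definition expanding_along_fibers : Prop :=
  exists C lambda : R, [/\ 0 < C, 1 < lambda &
    forall n : nat, (0 < n)%N ->
      ((C * lambda ^+ n)%:E <=
       ereal_inf [set (sph_deriv_norm (fiber_map z.1 n) z.2)%:E
                 | z in skew_Julia])%E].

End RationalGDMS.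

Arguments skew_product {R} S _.
Arguments skew_Julia {R} S _.

Definition topologically_exact_on (T : topologicalType) (f : T -> T)
    (J : set T) : Prop :=
  forall U : set T, open U -> U `&` J !=set0 ->
    exists N : nat, (0 < N)%N /\
      forall n : nat, (N <= n)%N -> J `<=` iter n f @` U.

(* Main.v *)
Require Import Defs.
From mathcomp Require Import all_boot all_order all_algebra.
From mathcomp Require Import all_classical all_reals all_analysis.
From mathcomp Require Import complex ring lra.

Set Implicit Arguments.
Unset Strict Implicit.
Unset Printing Implicit Defensive.

Import Order.TTheory GRing.Theory Num.Theory.
Import numFieldNormedType.Exports.

Local Open Scope classical_set_scope.
Local Open Scope ring_scope.
Local Open Scope complex_scope.

(** Let [(xi, z)] be a Julia point in an open set [U] and [(zeta, y)] any Julia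
    point.  For large [n] a word [om] is found that agrees with [xi] for a long
    time [M], so that [(om, z')] lies in [U] for all [z'] in a fixed disc [D] about
    [z], and whose [n]-th shift is [zeta].  Let [p] be the map along the first [M]
    letters and [x] a point that the remaining letters send to [y].  Suppose that no
    point of [D] goes to [y] along [om]; then [p] does not take the value [x] on [D].

    The skew Julia set is backward invariant because rational maps are open
    ([skew_Julia_preimage]), so [(sigma ^ M om, x)] and all its preimages under the
    first [M] steps are Julia points.  Expansion at these points makes inverse
    branches contract: a point that [p] sends within a definite distance of [x] is
    exponentially close to a preimage of [x] ([pullback]).  Hence on a smaller disc
    [p] omits a definite disc about [x], and the Schwarz lemma bounds its derivative
    at [z] by a constant depending only on the sizes of these two discs
    ([distortion]).  This contradicts the expansion along [xi] once [M] is large.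
    That a whole disc is omitted, rather than a few points, is what makes the
    Schwarz lemma applicable.

    Everything is derived from algebra of polynomials over the complex numbers.
    Distances are measured by [sqchord], which is [|u ^ v| ^ 2 / (|u| ^ 2 |v| ^ 2)]
    in homogeneous coordinates.  Factoring the form that defines the fibre over a
    point shows that rational maps are open with uniform constants ([Rat_open]); the
    Pluecker identity shows that they are Lipschitz ([Rat_lipschitz]).  The maximum
    principle for a quotient of polynomials is proved by multiplying its values at
    the [N]-th roots of a number, a discrete form of Jensen's formula
    ([max_circle]).  Applied twice, the Schwarz lemma controls the quotient to second
    order ([schwarz2]), which turns a pointwise expansion into one on a disc of
    uniform size ([block_expands]). *)

(** * The squared half-chord on the sphere *)

Section SquaredModulus.
Context {R : realType}.
Implicit Types z w : R[i].

Lemma sqnormc_ge0 z : 0 <= sqnormc z.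
Proof. by rewrite addr_ge0 ?sqr_ge0. Qed.

Lemma sqnormc0 : sqnormc (0 : R[i]) = 0.
Proof. by rewrite /sqnormc /= expr0n addr0. Qed.

Lemma sqnormc1 : sqnormc (1 : R[i]) = 1.
Proof. by rewrite /sqnormc /= expr0n expr1n addr0. Qed.

Lemma sqnormcN z : sqnormc (- z) = sqnormc z.
Proof. by case: z => a b; rewrite /sqnormc /= !sqrrN. Qed.

Lemma sqnormcM z w : sqnormc (z * w) = sqnormc z * sqnormc w.
Proof. by case: z w => [a b] [c d]; rewrite /sqnormc /=; ring. Qed.

Lemma sqnormc_eq0 z : (sqnormc z == 0) = (z == 0).
Proof. by rewrite eq_complex paddr_eq0 ?sqr_ge0// !sqrf_eq0. Qed.

Lemma sqnormc_gt0 z : (0 < sqnormc z) = (z != 0).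
Proof. by rewrite lt_def sqnormc_eq0 sqnormc_ge0 andbT. Qed.

Lemma sqnormcX z n : sqnormc (z ^+ n) = sqnormc z ^+ n.
Proof.
by elim: n => [|n IH]; rewrite ?expr0 ?sqnormc1// !exprS sqnormcM IH.
Qed.

Lemma sqnormcV z : sqnormc z^-1 = (sqnormc z)^-1.
Proof.
have [->|z0] := eqVneq z 0; first by rewrite !invr0 sqnormc0 invr0.
have n0 : sqnormc z != 0 by rewrite sqnormc_eq0.
by apply: (mulfI n0); rewrite -sqnormcM !divff// sqnormc1.
Qed.

Lemma sqnormc_div z w : sqnormc (z / w) = sqnormc z / sqnormc w.
Proof. by rewrite sqnormcM sqnormcV. Qed.

Lemma sqnormc_prod (I : Type) (r : seq I) (F : I -> R[i]) :
  sqnormc (\prod_(i <- r) F i) = \prod_(i <- r) sqnormc (F i).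
Proof.
by elim/big_ind2: _ => [|x1 x2 y1 y2 <- <-|//]; rewrite ?sqnormc1 ?sqnormcM.
Qed.

Lemma sqnormc_real (x : R) : sqnormc x%:C = x ^+ 2.
Proof. by rewrite /sqnormc /= expr0n addr0. Qed.

Lemma sqnormcD_le z w : sqnormc (z + w) <= 2 * sqnormc z + 2 * sqnormc w.
Proof.
case: z w => [a b] [c d]; rewrite /sqnormc /=.
have := sqr_ge0 (a - c); have := sqr_ge0 (b - d); nra.
Qed.

Lemma sqnormcB_le z w : sqnormc (z - w) <= 2 * sqnormc z + 2 * sqnormc w.
Proof. by rewrite -(sqnormcN w); exact: sqnormcD_le. Qed.

Lemma sqnormc_le_diff z w :
  sqnormc z <= 2 * sqnormc (z - w) + 2 * sqnormc w.
Proof. by rewrite -{1}[z](subrK w); exact: sqnormcD_le. Qed.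

End SquaredModulus.

Section Chordal.
Context {R : realType}.
Implicit Types (p q r : Chat R) (u v : R[i] * R[i]).

Definition wedge u v : R[i] := u.1 * v.2 - u.2 * v.1.

Definition sqn u : R := sqnormc u.1 + sqnormc u.2.

Definition hlift p : R[i] * R[i] := if p is Some z then (z, 1) else (1, 0).

Definition hproj u : Chat R := if u.2 == 0 then None else Some (u.1 / u.2).

(** A quarter of the squared Euclidean distance of the points of the unit sphere:
    in homogeneous coordinates the sine of half the spherical distance is
    [|u ^ v| / (|u| |v|)]. *)
Definition sqchord p q : R :=
  sqnormc (wedge (hlift p) (hlift q)) / (sqn (hlift p) * sqn (hlift q)).

Lemma sqn_ge0 u : 0 <= sqn u.
Proof. by rewrite addr_ge0 ?sqnormc_ge0. Qed.

Lemma sqn_eq0 u : (sqn u == 0) = (u == 0).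
Proof. by case: u => a b; rewrite paddr_eq0 ?sqnormc_ge0// !sqnormc_eq0. Qed.

Lemma sqn_gt0 u : (0 < sqn u) = (u != 0).
Proof. by rewrite lt_def sqn_eq0 sqn_ge0 andbT. Qed.

Lemma hlift_neq0 p : hlift p != 0.
Proof.
by case: p => [z|]; rewrite -sqn_eq0 /sqn /= sqnormc1 ?sqnormc0 ?addr0
  ?oner_eq0// gt_eqF// ltr_pwDr// sqnormc_ge0.
Qed.

Lemma hliftK p : hproj (hlift p) = p.
Proof. by case: p => [z|]; rewrite /hproj /= ?oner_eq0 ?divr1 ?eqxx. Qed.

Lemma sqn_hlift_ge1 p : 1 <= sqn (hlift p).
Proof.
case: p => [z|]; rewrite /sqn /= ?sqnormc1 ?sqnormc0 ?addr0//.
by rewrite lerDr sqnormc_ge0.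
Qed.

Lemma hproj_lift u : u != 0 ->
  exists2 t, t != 0 & u = (t * (hlift (hproj u)).1, t * (hlift (hproj u)).2).
Proof.
case: u => a b; rewrite /hproj /=; have [->|b0 _] := eqVneq b 0.
  move=> ab; exists a; last by rewrite /= mulr1 mulr0.
  by apply: contraNneq ab => ->.
by exists b => //=; rewrite mulr1 mulrC divfK.
Qed.

Lemma sqchordE u v : u != 0 -> v != 0 ->
  sqchord (hproj u) (hproj v) = sqnormc (wedge u v) / (sqn u * sqn v).
Proof.
move=> /hproj_lift[s s0 +] /hproj_lift[t t0 +]; rewrite /sqchord.
have := hlift_neq0 (hproj u); have := hlift_neq0 (hproj v).
move: (hlift (hproj u)) (hlift (hproj v)) => a b.
rewrite -!sqn_eq0 => b0 a0 -> ->.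
rewrite /wedge /sqn /=.
have -> : s * a.1 * (t * b.2) - s * a.2 * (t * b.1) =
  s * t * (a.1 * b.2 - a.2 * b.1) by ring.
rewrite !sqnormcM -!mulrDr -/(sqn a) -/(sqn b).
have ss : sqnormc s != 0 by rewrite sqnormc_eq0.
have tt : sqnormc t != 0 by rewrite sqnormc_eq0.
by field; rewrite a0 b0 ss tt.
Qed.

Lemma sqchord_stereo p q :
  sqchord p q = (1 - dot3 (stereo p) (stereo q)) / 2.
Proof.
have ne (z : R[i]) : 1 + sqnormc z != 0.
  by rewrite gt_eqF// ltr_pwDl// sqnormc_ge0.
case: p q => [z|] [w|]; rewrite /sqchord /wedge /sqn /dot3 /=
  ?sqnormc1 ?sqnormc0 ?mulr1 ?mul1r ?mulr0 ?mul0r ?subr0 ?sub0r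
  ?sqnormcN ?addr0 ?add0r ?sqnormc0 ?sqnormc1 ?mul0r ?subrr ?mul0r//.
- have Ez : sqnormc z = complex.Re z ^+ 2 + complex.Im z ^+ 2 by [].
  have Ew : sqnormc w = complex.Re w ^+ 2 + complex.Im w ^+ 2 by [].
  have Ezw : sqnormc (z - w) = sqnormc z + sqnormc w
    - 2 * (complex.Re z * complex.Re w + complex.Im z * complex.Im w).
    by case: z w {Ez Ew} => [a b] [c d]; rewrite /sqnormc /=; ring.
  move: (ne z) (ne w); rewrite Ezw; set s := sqnormc z; set t := sqnormc w.
  by move=> s0 t0; field; rewrite s0 t0.
- have := ne z; set s := sqnormc z; rewrite (addrC s) => s0.
  by field; rewrite s0.
- have := ne w; set s := sqnormc w; rewrite (addrC s) => s0.
  by field; rewrite s0.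
Qed.

Lemma dot3_sqchord p q : dot3 (stereo p) (stereo q) = 1 - 2 * sqchord p q.
Proof. by rewrite sqchord_stereo; field. Qed.

Lemma sqchord_ge0 p q : 0 <= sqchord p q.
Proof. by rewrite divr_ge0 ?sqnormc_ge0// mulr_ge0 ?sqn_ge0. Qed.

Lemma sqchord_le1 p q : sqchord p q <= 1.
Proof. by have /andP[+ _] := dot_stereo_itv p q; rewrite dot3_sqchord; lra. Qed.

Lemma sqchord_sym p q : sqchord p q = sqchord q p.
Proof. by rewrite !sqchord_stereo dot3C. Qed.

Lemma sqchordxx p : sqchord p p = 0.
Proof. by rewrite sqchord_stereo stereo_unit subrr mul0r. Qed.

Lemma sqchord_eq0 p q : sqchord p q = 0 -> p = q.
Proof.
by move=> h; apply: sph_dist_positivity;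
  rewrite /sph_dist dot3_sqchord h mulr0 subr0 acos1.
Qed.

(** The chord itself is Euclidean distance in three-space; squaring it costs a
    factor 2 in the triangle inequality but keeps every estimate polynomial. *)
Lemma sqchord_triangle q p r :
  sqchord p r <= 2 * sqchord p q + 2 * sqchord q r.
Proof.
rewrite !sqchord_stereo.
have := stereo_unit p; have := stereo_unit q; have := stereo_unit r.
case: (stereo p) (stereo q) (stereo r) => [[a b] c] [[x y] z] [[u v] w].
rewrite /dot3 /=.
have := sqr_ge0 (a + u - x *+ 2); have := sqr_ge0 (b + v - y *+ 2).
have := sqr_ge0 (c + w - z *+ 2); nra.
Qed.

Lemma hproj_eq u v : u != 0 -> v != 0 -> (hproj u = hproj v) <-> wedge u v = 0.
Proof.
move=> u0 v0; split=> [e|e].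
  have := sqchordE u0 v0; rewrite e sqchordxx => /esym/eqP.
  rewrite mulf_eq0 invr_eq0 mulf_eq0 !sqn_eq0 (negbTE u0) (negbTE v0) !orbF.
  by rewrite sqnormc_eq0 => /eqP.
by apply: sqchord_eq0; rewrite sqchordE// e sqnormc0 mul0r.
Qed.

Lemma sqchord_hlift u p : u != 0 ->
  sqnormc (wedge u (hlift p)) = sqchord (hproj u) p * (sqn u * sqn (hlift p)).
Proof.
move=> u0; rewrite -{2}[p]hliftK sqchordE ?hlift_neq0// divfK//.
by rewrite mulf_neq0 ?sqn_eq0 ?hlift_neq0.
Qed.

Lemma sqchord_far p q x : sqchord p q <= 4 * Num.max (sqchord x p) (sqchord x q).
Proof.
have := sqchord_triangle x p q; rewrite (sqchord_sym p x).
have : sqchord x p <= Num.max (sqchord x p) (sqchord x q).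
  by rewrite le_max lexx.
have : sqchord x q <= Num.max (sqchord x p) (sqchord x q).
  by rewrite le_max lexx orbT.
lra.
Qed.

(** The spherical distance [d] and the squared half-chord determine each other
    through [cos d = 1 - 2 sqchord], so both define the same neighbourhoods. *)
Lemma ball_sqchord p e : 0 < e ->
  exists2 d, 0 < d & forall q, sqchord p q < d -> sph_dist p q < e.
Proof.
move=> e0; pose e' := Num.min e pi.
have e'0 : 0 < e' by rewrite lt_min e0 pi_gt0.
have e'pi : e' <= pi by rewrite ge_min lexx orbT.
have c1 : cos e' < 1.
  by rewrite -cos0 ltr_cos// in_itv/= ?lexx ?pi_ge0// ltW.
exists ((1 - cos e') / 2); first by rewrite divr_gt0// subr_gt0.
move=> q h; apply: (@lt_le_trans _ _ e'); last by rewrite ge_min lexx.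
rewrite /sph_dist dot3_sqchord.
have D0 := sqchord_ge0 p q; have D1 := sqchord_le1 p q.
have i1 : -1 <= 1 - 2 * sqchord p q <= 1 by apply/andP; split; lra.
rewrite -ltr_cos ?in_itv/= ?acos_ge0 ?acos_lepi ?e'pi ?(ltW e'0)//.
by rewrite acosK ?in_itv//=; move: h; rewrite ltr_pdivlMr//; lra.
Qed.

Lemma sqchord_ball p d : 0 < d ->
  exists2 e, 0 < e & forall q, sph_dist p q < e -> sqchord p q < d.
Proof.
move=> d0; pose d' := Num.min d 1.
have d'0 : 0 < d' by rewrite lt_min d0 ltr01.
have d'1 : d' <= 1 by rewrite ge_min lexx orbT.
have i0 : -1 <= 1 - 2 * d' <= 1 by apply/andP; split; lra.
exists (acos (1 - 2 * d')); first by apply: acos_gt0; apply/andP; split; lra.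
move=> q h; apply: (@lt_le_trans _ _ d'); last by rewrite ge_min lexx.
move: h; rewrite /sph_dist dot3_sqchord => h.
have D0 := sqchord_ge0 p q; have D1 := sqchord_le1 p q.
have i1 : -1 <= 1 - 2 * sqchord p q <= 1 by apply/andP; split; lra.
move: h; rewrite -ltr_cos ?in_itv/= ?acos_ge0 ?acos_lepi//.
by rewrite !acosK ?in_itv//=; lra.
Qed.

Lemma nbhs_sqchord p (U : set (Chat R)) :
  nbhs p U <-> exists2 d, 0 < d & forall q, sqchord p q < d -> U q.
Proof.
split=> [/nbhs_ballP[e /= e0 eU]|[d d0 dU]].
  by have [d d0 de] := ball_sqchord p e0; exists d => // q /de /eU.
apply/nbhs_ballP; have [e e0 ed] := sqchord_ball p d0.
by exists e => //= q /ed /dU.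
Qed.

End Chordal.

(** * Rational maps as pairs of binary forms *)

Section LinearForms.
Context {R : realType}.
Implicit Types (p q x y : Chat R) (u v : R[i] * R[i]) (s : seq (Chat R)).

Lemma seq_pos_lower_bound (T : eqType) (f : T -> R) (s : seq T) :
  (forall x : T, x \in s -> 0 < f x) ->
  exists2 k, 0 < k & forall x : T, x \in s -> k <= f x.
Proof.
elim: s => [_|a s IH h]; first by exists 1.
have [x xs|k k0 hk] := IH; first by apply: h; rewrite inE xs orbT.
exists (Num.min k (f a)); first by rewrite lt_min k0 h ?mem_head.
move=> x; rewrite inE ge_min => /orP[/eqP ->|/hk ->//].
by rewrite lexx orbT.
Qed.

Lemma wedge_le u v : sqnormc (wedge u v) <= sqn u * sqn v.
Proof.
have [->|u0] := eqVneq u 0.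
  by rewrite /wedge /= !mul0r subrr sqnormc0 mulr_ge0 ?sqn_ge0.
have [->|v0] := eqVneq v 0.
  by rewrite /wedge /= !mulr0 subrr sqnormc0 mulr_ge0 ?sqn_ge0.
have := sqchord_le1 (hproj u) (hproj v).
by rewrite sqchordE// ler_pdivrMr ?mul1r// mulr_gt0 ?sqn_gt0.
Qed.

(** The binary form of degree [size s] vanishing exactly on [s]. *)
Definition linprod s u : R[i] := \prod_(x <- s) wedge u (hlift x).

Lemma linprod_sqnormc s u : u != 0 ->
  sqnormc (linprod s u) = (\prod_(x <- s) sqchord (hproj u) x) *
    (\prod_(x <- s) sqn (hlift x)) * sqn u ^+ size s.
Proof.
move=> u0; rewrite /linprod sqnormc_prod.
under eq_bigr do rewrite sqchord_hlift//.
elim: s => [|x s IH]; first by rewrite !big_nil !mulr1.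
by rewrite !big_cons IH /= exprS; ring.
Qed.

Lemma prod_sqn_ge1 s : 1 <= \prod_(x <- s) sqn (hlift x).
Proof.
by elim/big_rec: _ => // x y _ h; rewrite mulr_ege1// sqn_hlift_ge1.
Qed.

Lemma prod_sqchord_ge0 p s : 0 <= \prod_(x <- s) sqchord p x.
Proof. by apply: prodr_ge0 => x _; exact: sqchord_ge0. Qed.

Lemma prod_sqchord_le1 p s : \prod_(x <- s) sqchord p x <= 1.
Proof.
elim/big_rec: _ => // x y _ h; have := sqchord_le1 p x.
by have := sqchord_ge0 p x; nra.
Qed.

Lemma prod_sqchord_lower p s k : 0 <= k ->
  (forall x, x \in s -> k <= sqchord p x) ->
  k ^+ size s <= \prod_(x <- s) sqchord p x.
Proof.
move=> k0; elim: s => [|a s IH] h; first by rewrite big_nil.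
rewrite big_cons exprS ler_pM ?exprn_ge0//; first by apply: h; rewrite mem_head.
by apply: IH => x xs; apply: h; rewrite inE xs orbT.
Qed.

Lemma linprod_upper s u :
  u != 0 -> sqnormc (linprod s u) <=
    (\prod_(x <- s) sqn (hlift x)) * sqn u ^+ size s.
Proof.
move=> u0; rewrite linprod_sqnormc// -mulrA ler_piMl ?prod_sqchord_le1//.
rewrite mulr_ge0 ?exprn_ge0 ?sqn_ge0//.
exact: le_trans ler01 (prod_sqn_ge1 s).
Qed.

Lemma linprod_lower s u k : u != 0 -> 0 <= k ->
  (forall x, x \in s -> k <= sqchord (hproj u) x) ->
  k ^+ size s * sqn u ^+ size s <= sqnormc (linprod s u).
Proof.
move=> u0 k0 h; rewrite linprod_sqnormc//.
apply: ler_wpM2r; first by rewrite exprn_ge0 ?sqn_ge0.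
apply: le_trans (prod_sqchord_lower k0 h) _.
by rewrite ler_peMr ?prod_sqchord_ge0 ?prod_sqn_ge1.
Qed.

Lemma linprod_root s x : x \in s -> linprod s (hlift x) = 0.
Proof.
move=> xs; apply/eqP; rewrite /linprod prodf_seq_eq0; apply/hasP.
by exists x => //; rewrite /wedge mulrC subrr eqxx.
Qed.

(** Telescoping the difference of the two products, each step contributes
    [(u ^ a)(v ^ b) - (u ^ b)(v ^ a)], which the Pluecker identity rewrites as a
    multiple of [u ^ v]. *)
Lemma linprod_swap_le (l : seq (Chat R * Chat R)) :
  exists2 K, 0 <= K & forall u v,
    sqnormc (\prod_(c <- l) (wedge u (hlift c.1) * wedge v (hlift c.2)) -
             \prod_(c <- l) (wedge u (hlift c.2) * wedge v (hlift c.1))) *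
      (sqn u * sqn v) <=
    K * sqnormc (wedge u v) * (sqn u * sqn v) ^+ size l.
Proof.
elim: l => [|[a b] l [K K0 IH]].
  by exists 0 => // u v; rewrite !big_nil subrr sqnormc0 !mul0r.
pose B := \prod_(c <- l) (sqn (hlift c.1) * sqn (hlift c.2) : R).
have Bub u v :
    sqnormc (\prod_(c <- l) (wedge u (hlift c.1) * wedge v (hlift c.2))) <=
    B * (sqn u * sqn v) ^+ size l.
  rewrite /B sqnormc_prod; elim: (l) => [|[x y] t ih].
    by rewrite !big_nil mulr1.
  rewrite !big_cons /= exprS sqnormcM.
  rewrite (mulrACA (_ * _)) ler_pM ?mulr_ge0 ?sqnormc_ge0//.
    by apply: prodr_ge0 => c _; exact: sqnormc_ge0.
  by rewrite mulrACA (mulrC (sqn (hlift x))) (mulrC (sqn (hlift y)))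
    ler_pM ?sqnormc_ge0 ?wedge_le.
have B0 : 0 <= B by apply: prodr_ge0 => c _; rewrite mulr_ge0 ?sqn_ge0.
pose A := sqn (hlift a) * sqn (hlift b).
have A0 : 0 <= A by rewrite mulr_ge0 ?sqn_ge0.
exists (2 * A * B + 2 * A * K); first by have := mulr_ge0 A0 B0; have := mulr_ge0 A0 K0; lra.
move=> u v; rewrite !big_cons /= exprS.
move: (IH u v) (Bub u v).
set P1 := \prod_(c <- l) _; set P2 := \prod_(c <- l) _.
set W := sqn u * sqn v; set w := sqnormc (wedge u v) => h1 h2.
have W0 : 0 <= W by rewrite mulr_ge0 ?sqn_ge0.
have w0 : 0 <= w by exact: sqnormc_ge0.
set al := wedge u (hlift a) * wedge v (hlift b).
set be := wedge u (hlift b) * wedge v (hlift a).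
have -> : al * P1 - be * P2 = (al - be) * P1 + be * (P1 - P2) by ring.
have e : al - be = wedge u v * wedge (hlift a) (hlift b).
  by rewrite /al /be /wedge; ring.
have hab : sqnormc (al - be) <= w * A.
  by rewrite e sqnormcM ler_wpM2l// wedge_le.
have hb : sqnormc be <= W * A.
  rewrite /be sqnormcM /W /A.
  have -> : sqn u * sqn v * (sqn (hlift a) * sqn (hlift b)) =
    (sqn u * sqn (hlift b)) * (sqn v * sqn (hlift a)) by ring.
  by rewrite ler_pM ?sqnormc_ge0 ?wedge_le.
have Wn : 0 <= W ^+ size l by rewrite exprn_ge0.
apply: (@le_trans _ _ ((2 * ((w * A) * (B * W ^+ size l))
    + 2 * (W * A * sqnormc (P1 - P2))) * W)).
  rewrite ler_wpM2r//; apply: le_trans (sqnormcD_le _ _) _.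
  rewrite !sqnormcM in h2 hab hb *.
  by apply: lerD; apply: ler_wpM2l => //; [apply: ler_pM|apply: ler_wpM2r];
    rewrite ?mulr_ge0 ?sqnormc_ge0.
have -> : (2 * (w * A * (B * W ^+ size l)) + 2 * (W * A * sqnormc (P1 - P2))) * W
  = 2 * A * B * w * (W * W ^+ size l) + 2 * A * W * (sqnormc (P1 - P2) * W).
  by ring.
have -> : (2 * A * B + 2 * A * K) * w * (W * W ^+ size l) =
  2 * A * B * w * (W * W ^+ size l) + 2 * A * W * (K * w * W ^+ size l) by ring.
by rewrite lerD2l ler_wpM2l//; have := mulr_ge0 A0 W0; lra.
Qed.

End LinearForms.

Section HomogeneousLift.
Context {R : realType}.
Implicit Types (p q x y : Chat R) (u v : R[i] * R[i]) (s : seq (Chat R)).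
Implicit Types (P Q : {poly R[i]}).

(** The binary form of degree [d] that dehomogenises to [P]. *)
Definition hev d P u : R[i] := \sum_(k < d.+1) P`_k * u.1 ^+ k * u.2 ^+ (d - k).

Lemma hev_linear d (a b : R[i]) P Q u :
  hev d (a *: P + b *: Q) u = a * hev d P u + b * hev d Q u.
Proof.
rewrite /hev !mulr_sumr -big_split /=; apply: eq_bigr => k _.
by rewrite coefD !coefZ; ring.
Qed.

Lemma hev_inf d P (a : R[i]) : hev d P (a, 0) = P`_d * a ^+ d.
Proof.
rewrite /hev big_ord_recr /= subnn expr0 mulr1 big1 ?add0r// => k _.
by rewrite expr0n subn_eq0 leqNgt ltn_ord mulr0.
Qed.

Lemma hev_fin d P u : (size P <= d.+1)%N -> u.2 != 0 ->
  hev d P u = u.2 ^+ d * P.[u.1 / u.2].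
Proof.
move=> sP u2; rewrite (horner_coef_wide _ sP) mulr_sumr.
apply: eq_bigr => -[k /=]; rewrite ltnS => kd _.
rewrite exprMn exprVn -[in RHS](subnK kd) exprD.
have : u.2 ^+ k != 0 by rewrite expf_neq0.
by move: (u.2 ^+ k) => t t0; field.
Qed.

Lemma hev_split d P : P != 0 -> (size P <= d.+1)%N ->
  exists c s, [/\ c != 0, size s = d & forall u, hev d P u = c * linprod s u].
Proof.
move=> P0 sP; have [r Pr] := closed_field_poly_normal P.
have l0 : lead_coef P != 0 by rewrite lead_coef_eq0.
have sr : size P = (size r).+1.
  by rewrite {1}Pr size_scale// size_prod_XsubC.
have rd : (size r <= d)%N by rewrite -ltnS -sr.
exists (lead_coef P * (-1) ^+ (d - size r)),
  (map Some r ++ nseq (d - size r) None).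
split.
- by rewrite mulf_neq0// signr_eq0.
- by rewrite size_cat size_map size_nseq subnKC.
move=> [a b]; rewrite /linprod big_cat big_map big_nseq /= /wedge /=.
rewrite iter_mulr !mulr1 mulr0 sub0r.
have -> (S T : R[i]) : lead_coef P * (-1) ^+ (d - size r) * (S * T) =
  lead_coef P * S * ((-1) ^+ (d - size r) * T) by ring.
rewrite -exprMn mulN1r opprK.
have [->|b0] := eqVneq b 0; last first.
  rewrite hev_fin//= {1}Pr hornerZ horner_prod.
  have -> : \prod_(z <- r) (a - b * z) =
      b ^+ size r * \prod_(z <- r) ('X - z%:P).[a / b].
    elim: (r) => [|z t IH]; first by rewrite !big_nil mulr1.
    by rewrite !big_cons IH /= exprS hornerXsubC; field.
  by rewrite -[in b ^+ d](subnK rd) exprD; ring.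
rewrite hev_inf; under eq_bigr do rewrite mul0r subr0.
rewrite big_const_seq count_predT iter_mulr mulr1.
move: rd; rewrite leq_eqVlt => /predU1P[e|lt].
  by rewrite /lead_coef sr /= e subnn expr0 mulr1.
rewrite nth_default ?mul0r; last by rewrite sr.
by rewrite expr0n subn_eq0 leqNgt lt mulr0.
Qed.

(** In homogeneous coordinates infinity is a point like any other: [g] is induced
    by two binary forms of the same degree without common zero. *)
Definition hlifts (g : Chat R -> Chat R) d P Q :=
  [/\ (size P <= d.+1)%N, (size Q <= d.+1)%N &
   forall u, u != 0 -> (hev d P u, hev d Q u) != 0 /\
     g (hproj u) = hproj (hev d P u, hev d Q u)].

Lemma Rat_hlifts g : Defs.Rat g -> exists d P Q, hlifts g d P Q.
Proof.
move=> [[P [Q [cPQ gE]]] _].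
pose d := (maxn (size P) (size Q)).-1.
have PQ0 : (0 < maxn (size P) (size Q))%N.
  rewrite lt0n; apply/eqP => /eqP; rewrite -leqn0 geq_max !leqn0 !size_poly_eq0.
  by move=> /andP[/eqP P0 /eqP Q0]; move: cPQ; rewrite P0 Q0 coprime0p eqp01.
have dE : d.+1 = maxn (size P) (size Q) by rewrite prednK.
have sP : (size P <= d.+1)%N by rewrite dE leq_maxl.
have sQ : (size Q <= d.+1)%N by rewrite dE leq_maxr.
exists d, P, Q; split=> // -[a b] ab0.
have [b0|b0] := eqVneq b 0.
  move: ab0; rewrite b0 => a0; have {}a0 : a != 0.
    by apply: contraNneq a0 => ->.
  rewrite !hev_inf; have ad : a ^+ d != 0 by rewrite expf_neq0.
  have lead : (P`_d != 0) || (Q`_d != 0).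
    move: dE; rewrite /maxn; case: ifP => _ e.
      have -> : Q`_d = lead_coef Q by rewrite /lead_coef -e.
      by rewrite !lead_coef_eq0 -!size_poly_gt0 -e orbT.
    have -> : P`_d = lead_coef P by rewrite /lead_coef -e.
    by rewrite !lead_coef_eq0 -!size_poly_gt0 -e.
  split.
    apply/eqP => -[/eqP + /eqP]; rewrite !mulf_eq0 (negbTE ad) !orbF => h1 h2.
    by rewrite h1 h2 in lead.
  rewrite gE /fraction_map /hproj /= eqxx -/d mulf_eq0 (negbTE ad) orbF.
  by case: eqVneq => // q0; congr Some; field; rewrite q0 ad.
have bd : b ^+ d != 0 by rewrite expf_neq0.
rewrite !hev_fin//=; split.
  apply/eqP => -[/eqP + /eqP]; rewrite !mulf_eq0 (negbTE bd) /= => h1 h2.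
  by have := coprimep_root cPQ h1; rewrite h2.
rewrite gE /fraction_map /hproj /= (negbTE b0) mulf_eq0 (negbTE bd) /=.
by case: eqVneq => // q0; congr Some; field; rewrite q0 bd.
Qed.

Lemma Rat_neq g : Defs.Rat g -> exists p q, g p <> g q.
Proof.
move=> [_ nc]; apply: contrapT => h; apply: (nc (g None)); apply/funext => p.
by apply: contrapT => h2; apply: h; exists p, None.
Qed.

(** The zeros of the form obtained by pairing with [y] are the points of the fibre
    of [g] over [y], with multiplicity; it is not identically zero because [g] is
    not constant. *)
Lemma fibre_split g d P Q y : Defs.Rat g -> hlifts g d P Q ->
  exists c s, [/\ c != 0, size s = d & forall u,
    wedge (hev d P u, hev d Q u) (hlift y) = c * linprod s u].
Proof.
move=> gR [sP sQ gE]; pose F := (hlift y).2 *: P + (- (hlift y).1) *: Q.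
have FE u : wedge (hev d P u, hev d Q u) (hlift y) = hev d F u.
  by rewrite hev_linear /wedge /=; ring.
have sF : (size F <= d.+1)%N.
  rewrite (leq_trans (size_polyD _ _))// geq_max.
  by rewrite !(leq_trans (size_scale_leq _ _)).
suff F0 : F != 0.
  have [c [s [c0 ss E]]] := hev_split F0 sF.
  by exists c, s; split=> // u; rewrite FE E.
apply/eqP => F0; have [p [q]] := Rat_neq gR; apply.
suff gy x : g x = y by rewrite !gy.
have [n0 e] := gE _ (hlift_neq0 x); rewrite -{1}[x]hliftK e -[y]hliftK.
apply/hproj_eq => //; first exact: hlift_neq0.
by rewrite FE F0 /hev big1// => k _; rewrite coef0 !mul0r.
Qed.

Lemma Rat_surj g y : Defs.Rat g -> exists x, g x = y.
Proof.
move=> gR; have [d [P [Q gl]]] := Rat_hlifts gR; have [_ _ gE] := gl.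
have [c [s [c0 ss E]]] := fibre_split (g None) gR gl.
have d0 : (0 < d)%N.
  rewrite -ss lt0n size_eq0; apply/eqP => s0.
  have [n0 e] := gE _ (hlift_neq0 None).
  have := E (hlift None); rewrite s0 /linprod big_nil mulr1.
  move=> h; move/eqP: c0; apply; rewrite -h; apply/hproj_eq => //.
    exact: hlift_neq0.
  by rewrite hliftK -e hliftK.
have [c' [s' [_ ss' E']]] := fibre_split y gR gl.
case: s' ss' E' => [e|x s' _ E']; first by rewrite -e in d0.
exists x; have [n0 e] := gE _ (hlift_neq0 x).
rewrite -[x]hliftK e -[y]hliftK; apply/hproj_eq => //.
  exact: hlift_neq0.
by rewrite E' linprod_root ?mulr0// mem_head.
Qed.

(** The two forms cannot be small at the same point, because their zeros are
    pairwise a definite distance apart. *)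
Lemma hlift_bounds g d P Q : Defs.Rat g -> hlifts g d P Q ->
  exists m M, [/\ 0 < m, 0 < M & forall u, u != 0 ->
    m * sqn u ^+ d <= sqn (hev d P u, hev d Q u) <= M * sqn u ^+ d].
Proof.
move=> gR gl; have [_ _ gE] := gl.
have [b [t [b0 st Et]]] := fibre_split None gR gl.
have [a [s [a0 ss Es]]] := fibre_split (Some 0) gR gl.
have {}Et u : sqnormc (hev d Q u) = sqnormc b * sqnormc (linprod t u).
  by rewrite -sqnormcM -Et /wedge /= mulr0 mulr1 sub0r sqnormcN.
have {}Es u : sqnormc (hev d P u) = sqnormc a * sqnormc (linprod s u).
  by rewrite -sqnormcM -Es /wedge /= mulr0 mulr1 subr0.
have GE u : sqn (hev d P u, hev d Q u) =
    sqnormc a * sqnormc (linprod s u) + sqnormc b * sqnormc (linprod t u).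
  by rewrite /sqn /= Es Et.
have [k k0 hk] : exists2 k : R, 0 < k & forall x : Chat R * Chat R, x \in
    [seq (x, y) | x <- s, y <- t] -> k <= sqchord x.1 x.2.
  apply: seq_pos_lower_bound => _ /allpairsP[[x y] /= [xs yt ->]] /=.
  rewrite lt_def sqchord_ge0 andbT; apply/eqP => /sqchord_eq0 xy.
  have [+ _] := gE _ (hlift_neq0 x).
  by rewrite -sqn_eq0 GE !linprod_root// ?xy// sqnormc0 !mulr0 addr0 eqxx.
have A0 : 0 < sqnormc a by rewrite sqnormc_gt0.
have B0 : 0 < sqnormc b by rewrite sqnormc_gt0.
exists (Num.min (sqnormc a) (sqnormc b) * (k / 4) ^+ d),
  (sqnormc a * \prod_(x <- s) sqn (hlift x) +
   sqnormc b * \prod_(x <- t) sqn (hlift x)).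
have k4 : 0 < k / 4 by rewrite divr_gt0.
split.
- by rewrite mulr_gt0 ?exprn_gt0// lt_min A0 B0.
- by rewrite addr_gt0// mulr_gt0// (lt_le_trans ltr01 (prod_sqn_ge1 _)).
move=> u u0; rewrite GE; apply/andP; split; last first.
  rewrite [leRHS]mulrDl; apply: lerD; rewrite -mulrA ler_wpM2l ?sqnormc_ge0//.
    by rewrite -ss linprod_upper.
  by rewrite -st linprod_upper.
rewrite -mulrA.
have [hs|/existsNP[x /not_implyP[xs /negP]]] :=
    pselect (forall x, x \in s -> k / 4 <= sqchord (hproj u) x).
  apply: (@le_trans _ _ (sqnormc a * sqnormc (linprod s u))); last first.
    by rewrite lerDl mulr_ge0 ?sqnormc_ge0.
  rewrite ler_pM// ?mulr_ge0 ?exprn_ge0 ?sqn_ge0 ?(ltW k4)//.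
  - by rewrite le_min !sqnormc_ge0.
  - by rewrite ge_min lexx.
  - by rewrite -ss linprod_lower// ltW.
rewrite -ltNge => hx.
apply: (@le_trans _ _ (sqnormc b * sqnormc (linprod t u))); last first.
  by rewrite lerDr mulr_ge0 ?sqnormc_ge0.
rewrite ler_pM// ?mulr_ge0 ?exprn_ge0 ?sqn_ge0 ?(ltW k4)//.
- by rewrite le_min !sqnormc_ge0.
- by rewrite ge_min lexx orbT.
rewrite -st linprod_lower ?(ltW k4)// => y yt.
have /= := hk (x, y) (allpairs_f _ xs yt).
have := sqchord_triangle (hproj u) x y; rewrite (sqchord_sym x (hproj u)); lra.
Qed.

Lemma Rat_lipschitz g : Defs.Rat g ->
  exists2 L, 0 < L & forall p q, sqchord (g p) (g q) <= L * sqchord p q.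
Proof.
move=> gR; have [d [P [Q gl]]] := Rat_hlifts gR; have [_ _ gE] := gl.
have [m [M [m0 M0 mM]]] := hlift_bounds gR gl.
have [b [t [b0 st Et]]] := fibre_split None gR gl.
have [a [s [a0 ss Es]]] := fibre_split (Some 0) gR gl.
have {}Et u : hev d Q u = - (b * linprod t u).
  by have := Et u; rewrite /wedge /= mulr0 mulr1 sub0r => <-; rewrite opprK.
have {}Es u : hev d P u = a * linprod s u.
  by have := Es u; rewrite /wedge /= mulr0 mulr1 subr0.
have [K K0 hK] := linprod_swap_le (zip s t).
have C0 : 0 <= sqnormc (a * b) * K / m ^+ 2.

  by rewrite divr_ge0 ?sqr_ge0// mulr_ge0 ?sqnormc_ge0.
exists (sqnormc (a * b) * K / m ^+ 2 + 1); first by rewrite ltr_wpDl.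
move=> p q; apply: (@le_trans _ _ (sqnormc (a * b) * K / m ^+ 2 * sqchord p q));
  last by rewrite [leRHS]mulrDl lerDl mul1r sqchord_ge0.
set u := hlift p; set v := hlift q.
have u0 : u != 0 := hlift_neq0 p; have v0 : v != 0 := hlift_neq0 q.
have [nu eu] := gE _ u0; have [nv ev] := gE _ v0.
rewrite -{1}[p]hliftK -{1}[q]hliftK -/u -/v eu ev sqchordE//.
rewrite -[p]hliftK -[q]hliftK sqchordE// -/u -/v.
have /andP[lu _] := mM _ u0; have /andP[lv _] := mM _ v0.
have lprod (w1 w2 : R[i] * R[i]) : linprod s w1 * linprod t w2 =
    \prod_(c <- zip s t) (wedge w1 (hlift c.1) * wedge w2 (hlift c.2)).
  rewrite /linprod; elim: (s) (t) (etrans ss (esym st)) => [|x s' IH] [|y t'] //=.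
    by rewrite !big_nil mulr1.
  by move=> [/IH e]; rewrite !big_cons -e /=; ring.
have lprod' (w1 w2 : R[i] * R[i]) : linprod t w1 * linprod s w2 =
    \prod_(c <- zip s t) (wedge w1 (hlift c.2) * wedge w2 (hlift c.1)).
  by rewrite mulrC lprod; apply: eq_bigr => c _; rewrite mulrC.
have szip : size (zip s t) = d by rewrite size_zip ss st minnn.
have := hK u v; rewrite -lprod -lprod' szip => h.
have -> : sqnormc (wedge (hev d P u, hev d Q u) (hev d P v, hev d Q v)) =
   sqnormc (a * b) * sqnormc (linprod s u * linprod t v - linprod t u * linprod s v).
  by rewrite -sqnormcM -[RHS]sqnormcN; congr sqnormc;
    rewrite /wedge /= !Et !Es; ring.
set X := sqnormc (_ - _) in h *; set w := sqnormc (wedge u v) in h *.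
set Gu := sqn (hev d P u, _) in lu *; set Gv := sqn (hev d P v, _) in lv *.
have U0 : 0 < sqn u by rewrite sqn_gt0.
have V0 : 0 < sqn v by rewrite sqn_gt0.
have W0 : 0 < sqn u * sqn v by rewrite mulr_gt0.
have mu : 0 < m * sqn u ^+ d by rewrite mulr_gt0 ?exprn_gt0.
have mv : 0 < m * sqn v ^+ d by rewrite mulr_gt0 ?exprn_gt0.
rewrite ler_pdivrMr; last first.
  by rewrite mulr_gt0 ?(lt_le_trans mu lu) ?(lt_le_trans mv lv).
apply: (@le_trans _ _ (sqnormc (a * b) *
    (K * w * (sqn u * sqn v) ^+ d / (sqn u * sqn v)))).
  by rewrite ler_wpM2l ?sqnormc_ge0// ler_pdivlMr.
have -> : sqnormc (a * b) * (K * w * (sqn u * sqn v) ^+ d / (sqn u * sqn v)) =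
    sqnormc (a * b) * K / m ^+ 2 * (w / (sqn u * sqn v)) *
    ((m * sqn u ^+ d) * (m * sqn v ^+ d)).
  by rewrite exprMn; field; rewrite !gt_eqF.
apply: ler_wpM2l; first by rewrite mulr_ge0// divr_ge0 ?sqnormc_ge0// ltW.
by rewrite ler_pM// ltW.
Qed.

(** If [g p] is close to [y], the form cutting out the fibre over [y] is small
    at [p], so one of its linear factors is: [p] is close to the fibre.  The
    leading constant of that form is bounded below uniformly in [y] since [g]
    takes two different values, one of which is far from [y]. *)
Lemma Rat_open g : Defs.Rat g -> forall r, 0 < r -> exists2 e, 0 < e &
  forall p y, sqchord (g p) y < e -> exists2 x, g x = y & sqchord p x < r.
Proof.
move=> gR r r0; have [d [P [Q gl]]] := Rat_hlifts gR; have [_ _ gE] := gl.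
have [m [M [m0 M0 mM]]] := hlift_bounds gR gl.
have [p1 [p2 p12]] := Rat_neq gR.
pose D := sqchord (g p1) (g p2).
have D0 : 0 < D.
  by rewrite lt_def sqchord_ge0 andbT; apply/eqP => /sqchord_eq0.
pose r' := Num.min r 1.
have r'0 : 0 < r' by rewrite lt_min r0 ltr01.
exists (D / 4 * m / M * r' ^+ d).
  by rewrite mulr_gt0 ?exprn_gt0// divr_gt0// mulr_gt0// divr_gt0.
move=> p y hpy; have [c [s [c0 ss E]]] := fibre_split y gR gl.
have yy : 0 < sqn (hlift y) by rewrite sqn_gt0 hlift_neq0.
have chordE q : sqchord (g q) y *
    (sqn (hev d P (hlift q), hev d Q (hlift q)) * sqn (hlift y)) =
    sqnormc c * sqnormc (linprod s (hlift q)).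
  have [n0 e] := gE _ (hlift_neq0 q).
  by rewrite -{1}[q]hliftK e -sqchord_hlift// -sqnormcM -E.
pose A := sqnormc c * \prod_(x <- s) sqn (hlift x).
have qq q : 0 < sqn (hlift q) ^+ d by rewrite exprn_gt0// sqn_gt0 hlift_neq0.
have lowA q : D / 4 <= sqchord (g q) y -> D / 4 * m * sqn (hlift y) <= A.
  move=> hq; have /andP[lq _] := mM _ (hlift_neq0 q).
  rewrite -(ler_pM2r (qq q)); apply: (@le_trans _ _ (sqnormc c *
      sqnormc (linprod s (hlift q)))).
    rewrite -chordE.
    have -> : D / 4 * m * sqn (hlift y) * sqn (hlift q) ^+ d =
      D / 4 * (m * sqn (hlift q) ^+ d * sqn (hlift y)) by ring.
    have mq : 0 <= m * sqn (hlift q) ^+ d by rewrite mulr_ge0 ?ltW.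
    apply: ler_pM => //; first by rewrite divr_ge0// ltW.
      by rewrite mulr_ge0// ltW.
    by rewrite ler_wpM2r// ltW.
  rewrite /A -mulrA ler_wpM2l ?sqnormc_ge0// -ss.
  by rewrite linprod_upper ?hlift_neq0.
have {lowA} hA : D / 4 * m * sqn (hlift y) <= A.
  have := sqchord_far (g p1) (g p2) y; rewrite -/D !(sqchord_sym y) => hD.
  have : D / 4 <= Num.max (sqchord (g p1) y) (sqchord (g p2) y) by lra.
  by rewrite le_max => /orP[/lowA|/lowA].
apply: contrapT => hn.
have hs x : x \in s -> r' <= sqchord p x.
  move=> xs; rewrite leNgt; apply/negP => hx; apply: hn; exists x.
    have [n0 e] := gE _ (hlift_neq0 x).
    rewrite -[x]hliftK e -[y]hliftK; apply/hproj_eq => //.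
      exact: hlift_neq0.
    by rewrite E linprod_root ?mulr0.
  by apply: lt_le_trans hx _; rewrite ge_min lexx.
move: hpy; apply/negP; rewrite -leNgt.
have /andP[lp up] := mM _ (hlift_neq0 p).
set G := sqn (_, _) in lp up.
have G0 : 0 < G by apply: lt_le_trans lp; rewrite mulr_gt0.
have Gy : 0 < G * sqn (hlift y) by rewrite mulr_gt0.
rewrite -(ler_pM2r Gy) chordE linprod_sqnormc ?hlift_neq0// hliftK.
have hp : r' ^+ d <= \prod_(x <- s) sqchord p x.
  by rewrite -ss prod_sqchord_lower// ltW.
apply: (@le_trans _ _ (D / 4 * m / M * r' ^+ d *
    (M * sqn (hlift p) ^+ d * sqn (hlift y)))).
  rewrite ler_wpM2l ?ler_wpM2r ?(ltW yy)//.
  by rewrite ltW// mulr_gt0 ?exprn_gt0// divr_gt0// mulr_gt0// divr_gt0.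
have -> : D / 4 * m / M * r' ^+ d * (M * sqn (hlift p) ^+ d * sqn (hlift y)) =
  (D / 4 * m * sqn (hlift y)) * (r' ^+ d * sqn (hlift p) ^+ d).
  by field; rewrite gt_eqF.
have -> : sqnormc c * (\prod_(x <- s) sqchord p x *
    \prod_(x <- s) sqn (hlift x) * sqn (hlift p) ^+ size s) =
    A * (\prod_(x <- s) sqchord p x * sqn (hlift p) ^+ d).
  by rewrite /A ss; ring.
apply: ler_pM => //.
- by rewrite ltW// mulr_gt0// mulr_gt0// divr_gt0.
- by rewrite ltW// mulr_gt0// exprn_gt0.
- by rewrite ler_wpM2r// ltW.
Qed.

End HomogeneousLift.

(** * Maximum principle and Schwarz lemma for quotients of polynomials *)

Section MaximumPrinciple.
Context {R : realType}.
Implicit Types (A B P : {poly R[i]}) (a b c z w : R[i]) (r : seq R[i]).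

Lemma expr_eventually_lt (q e : R) : 0 <= q < 1 -> 0 < e ->
  exists N0 : nat, forall N, (N0 <= N)%N -> q ^+ N < e.
Proof.
move=> /andP[q0 q1] e0.
have /cvgr_lt : (fun n => q ^+ n) @ \oo --> (0 : R).
  by apply: cvg_expr; rewrite ger0_norm.
by move=> /(_ _ e0)[N0 _ h]; exists N0 => N hN; exact: h.
Qed.

Lemma le_of_exprn_le (x y K : R) (N0 : nat) : 0 <= x -> 0 <= y -> 0 <= K ->
  (forall N, (N0 <= N)%N -> x ^+ N <= K * y ^+ N) -> x <= y.
Proof.
move=> x0 y0 K0 h; rewrite leNgt; apply/negP => yx.
have xp : 0 < x := le_lt_trans y0 yx.
have q1 : 0 <= y / x < 1 by rewrite divr_ge0//= ltr_pdivrMr// mul1r.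
have K1 : 0 < (K + 1)^-1 by rewrite invr_gt0 ltr_wpDl.
have [N1 hN1] := expr_eventually_lt q1 K1.
have := hN1 _ (leq_maxr N0 N1); have := h _ (leq_maxl N0 N1).
move: (maxn N0 N1) => N hN; rewrite expr_div_n ltr_pdivrMr ?exprn_gt0//.
rewrite mulrC ltr_pdivlMr ?ltr_wpDl//.
have yN : 0 <= y ^+ N by rewrite exprn_ge0.
nra.
Qed.

Lemma avoid_finite (l : seq R) (x y : R) : x < y ->
  exists2 t, x < t < y & t \notin l.
Proof.
elim: l x y => [|h l IH] x y xy; first by exists ((x + y) / 2) => //; lra.
have [xh|hx] := ltP x h.
  have xm : x < Num.min h y by rewrite lt_min xh.
  have [t /andP[xt]] := IH _ _ xm; rewrite lt_min => /andP[th ty] tl.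
  by exists t; rewrite ?xt ?ty// inE negb_or tl lt_eqF.
have [t /andP[xt ty] tl] := IH _ _ xy; exists t; first by rewrite xt.
by rewrite inE negb_or tl gt_eqF// (le_lt_trans hx).
Qed.

Let circ (S : R) (N : nat) : R[i] := (Num.sqrt S ^+ N)%:C.

Let sqnormc_circ S N : 0 <= S -> sqnormc (circ S N) = S ^+ N.
Proof. by move=> S0; rewrite sqnormc_real exprAC sqr_sqrtr. Qed.

Lemma circle_roots (S : R) (N : nat) : 0 <= S -> (0 < N)%N -> exists r,
  [/\ size r = N, forall z, z \in r -> sqnormc z = S &
    forall a, \prod_(z <- r) sqnormc (z - a) = sqnormc (a ^+ N - circ S N)].
Proof.
move=> S0 N0; pose F : {poly R[i]} := 'X^N - (circ S N)%:P.
have [r Fr] := closed_field_poly_normal F.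
have mF : lead_coef F = 1 by rewrite lead_coefXnsubC.
move: Fr; rewrite mF scale1r => Fr; exists r; split.
- by apply/eqP; rewrite -eqSS -(size_XnsubC (circ S N) N0) -/F Fr
    size_prod_XsubC.
- move=> z zr; have : root F z by rewrite Fr root_prod_XsubC.
  rewrite /root !hornerE subr_eq0 => /eqP e; apply: (pexpIrn N0);
    rewrite ?nnegrE ?sqnormc_ge0//.
  by rewrite -sqnormcX e sqnormc_circ.
- move=> a; have -> : a ^+ N - circ S N = F.[a] by rewrite !hornerE.
  rewrite Fr horner_prod sqnormc_prod; apply: eq_bigr => z _.
  by rewrite hornerXsubC -sqnormcN opprB.
Qed.

Lemma prod_circle_roots (S : R) N l (s r : seq R[i]) P : size r = N ->
  (forall a, \prod_(z <- r) sqnormc (z - a) = sqnormc (a ^+ N - circ S N)) ->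
  P = l *: \prod_(a <- s) ('X - a%:P) ->
  \prod_(z <- r) sqnormc P.[z] =
    sqnormc l ^+ N * \prod_(a <- s) sqnormc (a ^+ N - circ S N).
Proof.
move=> sr hr ->.
under eq_bigr do rewrite hornerZ horner_prod sqnormcM sqnormc_prod.
rewrite big_split /= big_const_seq count_predT sr iter_mulr mulr1; congr (_ * _).
rewrite exchange_big /=; apply: eq_bigr => a _; rewrite -hr.
by apply: eq_bigr => z _; rewrite hornerXsubC.
Qed.

Lemma roots_eventually (S : R) (s : seq R[i]) : 0 < S ->
  (forall a, a \in s -> sqnormc a != S) ->
  exists N0 : nat, forall N, (N0 <= N)%N ->
  \prod_(a <- s) sqnormc a ^+ N <=
    4 ^+ size s * \prod_(a <- s) sqnormc (a ^+ N - circ S N).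
Proof.
move=> S0; elim: s => [_|a s IH h].
  by exists 0%N => N _; rewrite !big_nil mulr1.
have [x xs|N1 hN1] := IH; first by apply: h; rewrite inE xs orbT.
suff [N2 hN2] : exists N2 : nat, forall N, (N2 <= N)%N ->
    sqnormc a ^+ N <= 4 * sqnormc (a ^+ N - circ S N).
  exists (maxn N1 N2) => N; rewrite geq_max => /andP[/hN1 h1 /hN2 h2].
  rewrite !big_cons /= exprS mulrACA ler_pM ?exprn_ge0 ?sqnormc_ge0//.
  by apply: prodr_ge0 => x _; rewrite exprn_ge0 ?sqnormc_ge0.
have aS := h a (mem_head _ _); have e4 : 0 < 4^-1 :> R by rewrite invr_gt0.
have [lt|gt] := ltP (sqnormc a) S.
  have q1 : 0 <= sqnormc a / S < 1.
    by rewrite divr_ge0 ?sqnormc_ge0 ?(ltW S0)//= ltr_pdivrMr// mul1r.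
  have [N2 hN2] := expr_eventually_lt q1 e4; exists N2 => N /hN2.
  rewrite expr_div_n ltr_pdivrMr ?exprn_gt0// -sqnormcX.
  have := sqnormc_le_diff (circ S N) (a ^+ N).
  rewrite sqnormc_circ ?(ltW S0)// -(sqnormcN (_ - _)) opprB.
  by have := sqnormc_ge0 (a ^+ N); lra.
have {aS}gt : S < sqnormc a by rewrite lt_neqAle eq_sym aS.
have a0 : 0 < sqnormc a := lt_trans S0 gt.
have q1 : 0 <= S / sqnormc a < 1.
  by rewrite divr_ge0 ?(ltW S0) ?(ltW a0)//= ltr_pdivrMr// mul1r.
have [N2 hN2] := expr_eventually_lt q1 e4; exists N2 => N /hN2.
rewrite expr_div_n ltr_pdivrMr ?exprn_gt0// -sqnormcX.
have := sqnormc_le_diff (a ^+ N) (circ S N).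
by rewrite sqnormc_circ ?(ltW S0)//; lra.
Qed.

(** Jensen's formula in place of an integral: the product of [A / B] over the
    [N] roots of [X ^ N - t], [t] real of squared modulus [S ^ N], is explicit
    in terms of the zeros of [A] and [B], namely a product of factors
    [a ^ N - t].  When [A] has no zero on the circle and [B] none in the disc, it is
    for large [N] at least the [N]-th power of the value at the centre, up to a
    factor independent of [N]; extracting [N]-th roots removes that factor. *)
Lemma max_circle A B (S M : R) : 0 < S -> 0 <= M ->
  (forall z, sqnormc z = S -> A.[z] != 0) ->
  (forall z, sqnormc z <= S -> B.[z] != 0) ->
  (forall z, sqnormc z = S -> sqnormc A.[z] <= M * sqnormc B.[z]) ->
  sqnormc A.[0] <= M * sqnormc B.[0].
Proof.
move=> S0 M0 A0 B0 AB.
have [s As] := closed_field_poly_normal A.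
have [t Bt] := closed_field_poly_normal B.
set lA := lead_coef A in As; set lB := lead_coef B in Bt.
have at0 P l (u : seq R[i]) : P = l *: \prod_(a <- u) ('X - a%:P) ->
    forall N, sqnormc P.[0] ^+ N = sqnormc l ^+ N * \prod_(a <- u) sqnormc a ^+ N.
  move=> -> N; rewrite hornerZ horner_prod sqnormcM sqnormc_prod exprMn.
  rewrite -prodrXl; congr (_ * _); apply: eq_bigr => a _.
  by rewrite hornerXsubC sub0r sqnormcN.
have An0 : lA != 0.
  rewrite lead_coef_eq0; apply/eqP => e.
  have := A0 (circ S 1); rewrite sqnormc_circ ?ltW// expr1 e horner0 eqxx.
  by move=> /(_ erefl).
have Bn0 : lB != 0.
  rewrite lead_coef_eq0; apply/eqP => e.
  by have := B0 0; rewrite sqnormc0 e horner0 eqxx => /(_ (ltW S0)).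
have sS a : a \in s -> sqnormc a != S.
  move=> as_; apply/eqP => /A0; rewrite As hornerZ mulf_eq0 (negbTE An0) /=.
  by rewrite -/(root _ _) root_prod_XsubC as_.
have tS a : a \in t -> S < sqnormc a.
  move=> at_; rewrite ltNge; apply/negP => /B0.
  by rewrite Bt hornerZ mulf_eq0 (negbTE Bn0) /= -/(root _ _)
    root_prod_XsubC at_.
have [N0 hN0] := roots_eventually S0 sS.
apply: (@le_of_exprn_le _ _ (4 ^+ size s * 4 ^+ size t) (maxn 1 N0)).
- exact: sqnormc_ge0.
- by rewrite mulr_ge0 ?sqnormc_ge0.
- by rewrite mulr_ge0 ?exprn_ge0.
move=> N; rewrite geq_max => /andP[N1 NN0].
have [r [sr rS hr]] := circle_roots (ltW S0) N1.
rewrite exprMn (at0 _ _ _ As) (at0 _ _ _ Bt).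
have hA := prod_circle_roots sr hr As; have hB := prod_circle_roots sr hr Bt.
have AB' : \prod_(z <- r) sqnormc A.[z] <= M ^+ N * \prod_(z <- r) sqnormc B.[z].
  have -> : M ^+ N = \prod_(z <- r) M.
    by rewrite big_const_seq count_predT sr iter_mulr mulr1.
  rewrite -big_split /= big_seq [leRHS]big_seq; apply: ler_prod => z /rS zS.
  by rewrite sqnormc_ge0 AB.
have Bup : \prod_(a <- t) sqnormc (a ^+ N - circ S N) <=
    4 ^+ size t * \prod_(a <- t) sqnormc a ^+ N.
  have -> : 4 ^+ size t = \prod_(a <- t) (4 : R).
    by rewrite big_const_seq count_predT iter_mulr mulr1.
  rewrite -big_split /= big_seq [leRHS]big_seq; apply: ler_prod => a /tS aS.
  rewrite sqnormc_ge0 /=; apply: le_trans (sqnormcB_le _ _) _.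
  rewrite sqnormc_circ ?(ltW S0)// sqnormcX.
  have : S ^+ N <= sqnormc a ^+ N.
    by rewrite lerXn2r ?nnegrE ?sqnormc_ge0 ?(ltW S0)// ltW.
  lra.
have lA0 : 0 <= sqnormc lA ^+ N by rewrite exprn_ge0 ?sqnormc_ge0.
have lB0 : 0 <= sqnormc lB ^+ N by rewrite exprn_ge0 ?sqnormc_ge0.
apply: (@le_trans _ _ (4 ^+ size s * \prod_(z <- r) sqnormc A.[z])).
  by rewrite hA mulrCA ler_wpM2l// hN0.
rewrite -[leRHS]mulrA; apply: ler_wpM2l; first by rewrite exprn_ge0.
apply: le_trans AB' _; rewrite hB [leRHS]mulrCA; apply: ler_wpM2l.
  by rewrite exprn_ge0.
by rewrite [leRHS]mulrCA; apply: ler_wpM2l.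
Qed.

Lemma max_principle A B c (S1 S2 M : R) : 0 <= S1 -> S1 < S2 -> 0 <= M ->
  (forall z, sqnormc (z - c) < S2 -> B.[z] != 0) ->
  (forall z, S1 < sqnormc (z - c) < S2 -> sqnormc A.[z] <= M * sqnormc B.[z]) ->
  sqnormc A.[c] <= M * sqnormc B.[c].
Proof.
move=> S10 S12 M0 B0 AB.
have [->|A0] := eqVneq A 0.
  by rewrite horner0 sqnormc0 mulr_ge0 ?sqnormc_ge0.
pose A' := A \Po ('X + c%:P); pose B' := B \Po ('X + c%:P).
have A'E z : A'.[z] = A.[z + c] by rewrite horner_comp !hornerE.
have B'E z : B'.[z] = B.[z + c] by rewrite horner_comp !hornerE.
have [s As] := closed_field_poly_normal A.
have [S /andP[S1S SS2] Ss] := avoid_finite [seq sqnormc (a - c) | a <- s] S12.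
have := @max_circle A' B' S M; rewrite A'E B'E add0r; apply=> //.
- exact: le_lt_trans S10 S1S.
- move=> z zS; rewrite A'E; apply: contraNneq Ss => e; apply/mapP.
  exists (z + c); last by rewrite addrK.
  have : root A (z + c) by rewrite /root e.
  by rewrite As rootZ ?lead_coef_eq0// root_prod_XsubC.
- by move=> z zS; rewrite B'E B0// addrK (le_lt_trans zS).
- by move=> z zS; rewrite A'E B'E AB// addrK zS S1S.
Qed.

(** The quotient [A / (z B)] obeys the bound [64 M / S] on [|z| ^ 2 >= S / 64];
    the maximum principle on discs around the remaining points, whose boundary
    circles stay in that region, extends it to the whole disc. *)
Lemma schwarz A B T (S M : R) : 0 < S -> 0 <= M ->
  (forall z, sqnormc z < S -> B.[z] != 0) ->
  (forall z, sqnormc z < S -> sqnormc A.[z] <= M * sqnormc B.[z]) ->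
  A = T * 'X ->
  forall z, sqnormc z < S -> sqnormc T.[z] <= 64 * M / S * sqnormc B.[z].
Proof.
move=> S0 M0 B0 AB AT.
have outer z : S / 64 <= sqnormc z < S ->
    sqnormc T.[z] <= 64 * M / S * sqnormc B.[z].
  move=> /andP[z1 z2]; have := AB z z2.
  rewrite AT hornerM hornerX sqnormcM => h.
  have := ler_wpM2l (sqnormc_ge0 T.[z]) z1 => h2.
  have -> : 64 * M / S * sqnormc B.[z] = M * sqnormc B.[z] / (S / 64).
    by field; rewrite gt_eqF.
  rewrite ler_pdivlMr; last by rewrite divr_gt0.
  exact: le_trans h2 h.
move=> z zS; have [z1|z1] := leP (S / 64) (sqnormc z).
  by apply: outer; rewrite z1 zS.
apply: (@max_principle T B z (S / 4) (S / 3)).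
- by rewrite divr_ge0// ltW.
- lra.
- by rewrite divr_ge0 ?mulr_ge0// ltW.
- move=> w wz; apply: B0; have := sqnormc_le_diff w z; lra.
- move=> w /andP[w1 w2]; apply: outer; apply/andP; split.
    have := sqnormcB_le w z; lra.
  have := sqnormc_le_diff w z; lra.
Qed.

End MaximumPrinciple.

(** * Distortion of bounded quotients near the origin *)

Section Distortion.
Context {R : realType}.
Implicit Types (A B T : {poly R[i]}) (z w : R[i]) (p : Chat R -> Chat R).

Lemma ge0_at_limit (a b x1 : R) : 0 < x1 ->
  (forall x, 0 < x < x1 -> x <= 1 -> 0 <= a + x * b) -> 0 <= a.
Proof.
move=> x10 h; rewrite leNgt; apply/negP => a0.
pose b1 := 2 * (Num.max b 0 + 1); have b10 : 0 < b1.
  by rewrite mulr_gt0// ltr_wpDl// le_max lexx orbT.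
pose x := Num.min (Num.min (x1 / 2) 1) (- a / b1).
have x0 : 0 < x by rewrite !lt_min ltr01 !divr_gt0 ?oppr_gt0.
have xx1 : x <= x1 / 2 by rewrite !ge_min lexx.
have x1' : x <= 1 by rewrite !ge_min lexx orbT.
have xa : x <= - a / b1 by rewrite ge_min lexx orbT.
have := h x; rewrite x0 x1' /= => /(_ _ isT); have -> : x < x1 by lra.
move=> /(_ isT); move: xa; rewrite ler_pdivlMr// /b1 => xa.
have : x * b <= x * Num.max b 0 by rewrite ler_wpM2l ?(ltW x0)// le_max lexx.
lra.
Qed.

Lemma root0_factor A : A.[0] = 0 -> exists T, A = T * 'X.
Proof.
move=> A0; have /factor_theorem[T TE] : root A 0 by rewrite /root A0.
by exists T; rewrite TE polyC0 subr0.
Qed.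

(** Writing [A / B] to second order at [0], [f z = f 0 + z (q + z h z)], two
    applications of the Schwarz lemma bound [q] and [h]. *)
Lemma schwarz2 A B (S M : R) : 0 < S -> 0 <= M ->
  (forall z, sqnormc z < S -> B.[z] != 0) ->
  (forall z, sqnormc z < S -> sqnormc A.[z] <= M * sqnormc B.[z]) ->
  exists (q : R[i]) (h : R[i] -> R[i]),
    [/\ sqnormc q <= 256 * M / S,
     forall z, sqnormc z < S -> sqnormc (h z) <= 256 * (256 * M / S) / S,
     forall z, sqnormc z < S -> sqnormc (q + z * h z) <= 256 * M / S &
     forall z, sqnormc z < S ->
       A.[z] / B.[z] - A.[0] / B.[0] = z * (q + z * h z)].
Proof.
move=> S0 M0 B0 AB; have z0S : sqnormc (0 : R[i]) < S by rewrite sqnormc0.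
have B00 := B0 _ z0S.
have BB z : sqnormc z < S -> 0 < sqnormc B.[z] by move=> /B0; rewrite sqnormc_gt0.
pose c := A.[0] / B.[0]; pose A1 := A - c *: B.
have c1 : sqnormc c <= M by rewrite sqnormc_div ler_pdivrMr ?BB// AB.
have [T TE] : exists T, A1 = T * 'X.
  by apply: root0_factor; rewrite !hornerE /c divfK// subrr.
have A1b z : sqnormc z < S -> sqnormc A1.[z] <= 4 * M * sqnormc B.[z].
  move=> zS; rewrite hornerD hornerN hornerZ.
  apply: le_trans (sqnormcB_le _ _) _; rewrite sqnormcM; have := AB z zS.
  have := ler_wpM2r (ltW (BB z zS)) c1; lra.
have Tb := schwarz S0 (mulr_ge0 (ler0n R 4) M0) B0 A1b TE.
pose q := T.[0] / B.[0]; pose A2 := T - q *: B.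
have [T2 T2E] : exists T2, A2 = T2 * 'X.
  by apply: root0_factor; rewrite !hornerE /q divfK// subrr.
pose K := 64 * (4 * M) / S.
have K0 : 0 <= K.
  exact: divr_ge0 (mulr_ge0 (ler0n _ 64) (mulr_ge0 (ler0n _ 4) M0)) (ltW S0).
have qK : sqnormc q <= K by rewrite sqnormc_div ler_pdivrMr ?BB// Tb.
have A2b z : sqnormc z < S -> sqnormc A2.[z] <= 4 * K * sqnormc B.[z].
  move=> zS; rewrite hornerD hornerN hornerZ.
  apply: le_trans (sqnormcB_le _ _) _; rewrite sqnormcM.
  have := Tb z zS; have := ler_wpM2r (ltW (BB z zS)) qK; rewrite -/K; lra.
have T2b := schwarz S0 (mulr_ge0 (ler0n R 4) K0) B0 A2b T2E.
have KE : 256 * M / S = K by rewrite /K; field; rewrite gt_eqF.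
have Tq z : sqnormc z < S -> q + z * (T2.[z] / B.[z]) = T.[z] / B.[z].
  move=> zS; have -> : T.[z] = A2.[z] + q * B.[z] by rewrite !hornerE subrK.
  rewrite T2E hornerM hornerX; field; exact: B0.
exists q, (fun z => T2.[z] / B.[z]); split.
- by rewrite KE.
- move=> z zS; rewrite sqnormc_div ler_pdivrMr ?BB//.
  have -> : 256 * (256 * M / S) / S = 64 * (4 * K) / S.
    by rewrite KE; field; rewrite gt_eqF.
  exact: T2b.
- by move=> z zS; rewrite Tq// sqnormc_div ler_pdivrMr ?BB// KE; exact: Tb.
- move=> z zS; rewrite Tq//.
  have -> : A.[z] = A1.[z] + c * B.[z] by rewrite !hornerE subrK.
  by rewrite TE hornerM hornerX -/c; field; exact: B0.
Qed.

(** Letting [z] tend to [0], the assumed expansion becomes a lower bound for the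
    derivative [q] of [f] at [0].  On a disc depending only on [S] and [M] the
    second-order term of [schwarz2] is at most [|q| / 2], so the difference
    quotient stays comparable to [q]; the factor 64 covers this and the variation
    of the spherical factors [1 + |f z| ^ 2]. *)
Lemma affine_distortion A B (S M e r : R) : 0 < S -> 0 <= M -> 4 <= e -> 0 < r ->
  (forall z, sqnormc z < S -> B.[z] != 0) ->
  (forall z, sqnormc z < S -> sqnormc A.[z] <= M * sqnormc B.[z]) ->
  let f z := A.[z] / B.[z] in
  (forall z, sqnormc z < r -> e * sqnormc z *
     ((1 + sqnormc (f z)) * (1 + sqnormc (f 0))) <=
     sqnormc (f z - f 0) * (1 + sqnormc z)) ->
  e <= 4 * (256 * M / S) /\
  forall z, sqnormc z < S -> sqnormc z * (256 * (256 * M / S) / S) <= 1 / 4 ->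
    sqnormc z * (256 * M / S) <= 1 ->
    e / 64 * sqnormc z * ((1 + sqnormc (f z)) * (1 + sqnormc (f 0))) <=
      sqnormc (f z - f 0) * (1 + sqnormc z).
Proof.
move=> S0 M0 e4 r0 B0 AB f he.
have [q [h [q1 h1 qh fE]]] := schwarz2 S0 M0 B0 AB.
set K := 256 * M / S in q1 h1 qh *; set L := 256 * K / S in h1 *.
set F := 1 + sqnormc (f 0).
have F1 : 1 <= F by rewrite lerDl sqnormc_ge0.
have K0 : 0 <= K := divr_ge0 (mulr_ge0 (ler0n _ 256) M0) (ltW S0).
have L0 : 0 <= L := divr_ge0 (mulr_ge0 (ler0n _ 256) K0) (ltW S0).
have fd z : sqnormc z < S -> sqnormc (f z - f 0) <= sqnormc z * K.
  by move=> zS; rewrite /f fE// sqnormcM ler_wpM2l ?sqnormc_ge0// qh.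
have Q : e * F ^+ 2 / 4 <= sqnormc q.
  suff : 0 <= 2 * sqnormc q - e * F ^+ 2 / 2 by lra.
  have x10 : 0 < Num.min r S by rewrite lt_min r0 S0.
  apply: (@ge0_at_limit _ (4 * L + 2 * sqnormc q + e * K * F) _ x10).
  move=> x /andP[x0]; rewrite lt_min => /andP[xr xS] x1.
  pose z : R[i] := (Num.sqrt x)%:C.
  have zx : sqnormc z = x by rewrite sqnormc_real sqr_sqrtr// ltW.
  have zS : sqnormc z < S by rewrite zx.
  have zr : sqnormc z < r by rewrite zx.
  have := he z zr; have := fd z zS; have := h1 z zS.
  have := sqnormc_le_diff (f 0) (f z); rewrite -(sqnormcN (f 0 - _)) opprB.
  rewrite [in X in _ -> _ -> _ -> X]/f (fE _ zS) -/(f z) -/(f 0) sqnormcM zx.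
  have := sqnormcD_le q (z * h z); rewrite sqnormcM zx -/F.
  set G := sqnormc (q + _); move: (sqnormc (f z)) (sqnormc (f z - f 0)) => a b.
  move: (sqnormc (h z)) => hz G1 a1 hz1 b1 h2.
  have h3 : e * ((1 + a) * F) <= G * (1 + x) by rewrite -(ler_pM2l x0); lra.
  have a2 : F / 2 - x * K <= 1 + a by move: a1 b1; rewrite /F; lra.
  have h4 : e * ((F / 2 - x * K) * F) <= e * ((1 + a) * F).
    by rewrite ler_wpM2l ?ler_wpM2r//; lra.
  have q0 := sqnormc_ge0 q.
  have G2 : G <= 2 * sqnormc q + 2 * (x * L).
    by apply: le_trans G1 _; rewrite lerD2l ler_wpM2l// ler_wpM2l// ltW.
  have h5 : G * (1 + x) <= (2 * sqnormc q + 2 * (x * L)) * (1 + x).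
    by rewrite ler_wpM2r//; lra.
  have xx : 2 * (x * L) * x <= 2 * (x * L).
    by rewrite ler_piMr// mulr_ge0// mulr_ge0// ltW.
  lra.
have eF : e <= e * F ^+ 2.
  by rewrite ler_peMr ?expr_ge1//; lra.
split.
  by rewrite -/K; lra.
move=> z zS zL zK; rewrite -/F.
have := fd z zS; have := h1 z zS; have := sqnormc_le_diff q (- (z * h z)).
rewrite sqnormcN opprK sqnormcM.
have := sqnormc_le_diff (f z) (f 0); rewrite {3}/f (fE _ zS) -/(f 0) sqnormcM.
set G := sqnormc (q + _); set x := sqnormc z in zL zK *.
have x0 : 0 <= x := sqnormc_ge0 z.
move: (sqnormc (f z)) (sqnormc (f z - f 0)) => a b a1 Gq hz hb.
have xh : x * sqnormc (h z) <= 1 / 4.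
  by apply: le_trans zL; rewrite ler_wpM2l.
have G1 : e * F ^+ 2 / 16 <= G by lra.
have hF : (1 + a) * F <= 4 * F ^+ 2.
  rewrite expr2 mulrA ler_wpM2r//; first by lra.
  have := sqnormc_ge0 (f 0); move: a1 hb; rewrite /F; lra.
have h1' : e / 64 * x * ((1 + a) * F) <= e / 64 * x * (4 * F ^+ 2).
  by rewrite ler_wpM2l// mulr_ge0//; lra.
have h2' : x * (e * F ^+ 2 / 16) <= x * G by rewrite ler_wpM2l.
have h3' : 0 <= x * G * x by rewrite mulr_ge0// mulr_ge0// sqnormc_ge0.
lra.
Qed.

End Distortion.

(** * Distortion of compositions of rational maps *)

Section Rotations.
Context {R : realType}.
Implicit Types (a b z : R[i]) (p q w x : Chat R) (u v : R[i] * R[i]).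

(** A multiple of the unitary matrix with first row [(a, b)]; on the sphere it
    acts as a rotation. *)
Definition rotv a b u : R[i] * R[i] :=
  (a * u.1 + b * u.2, conjc a * u.2 - conjc b * u.1).

Definition rot a b p : Chat R := hproj (rotv a b (hlift p)).

Lemma sqnormc_conjc z : sqnormc (conjc z) = sqnormc z.
Proof. by case: z => x y; rewrite /sqnormc /= sqrrN. Qed.

Lemma conj_pair_neq0 a b : (a, b) != 0 -> (conjc a, - b) != 0.
Proof. by rewrite -!sqn_eq0 /sqn /= sqnormcN sqnormc_conjc. Qed.

Lemma sqn_rotv a b u : sqn (rotv a b u) = sqn (a, b) * sqn u.
Proof.
case: a b u => [a1 a2] [b1 b2] [[u1 u2] [v1 v2]].
by rewrite /sqn /rotv /sqnormc /=; ring.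
Qed.

Lemma wedge_rotv a b u v :
  wedge (rotv a b u) (rotv a b v) = (a * conjc a + b * conjc b) * wedge u v.
Proof. by rewrite /wedge /rotv /=; ring. Qed.

Lemma sqnormc_rot_det a b :
  sqnormc (a * conjc a + b * conjc b) = sqn (a, b) ^+ 2.
Proof.
case: a b => [a1 a2] [b1 b2].
by rewrite /sqn /sqnormc /=; ring.
Qed.

Lemma rotv_neq0 a b u : (a, b) != 0 -> u != 0 -> rotv a b u != 0.
Proof.
move=> ab u0; rewrite -sqn_eq0 sqn_rotv mulf_neq0//.
  by rewrite sqn_eq0.
by rewrite sqn_eq0.
Qed.

Lemma sqchord_rot a b p q : (a, b) != 0 ->
  sqchord (rot a b p) (rot a b q) = sqchord p q.
Proof.
move=> ab; rewrite /rot sqchordE ?rotv_neq0 ?hlift_neq0//.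
rewrite wedge_rotv sqnormcM sqnormc_rot_det !sqn_rotv /sqchord.
have := hlift_neq0 p; have := hlift_neq0 q; move: ab; rewrite -!sqn_eq0.
move: (sqn _) (sqn _) (sqn _) (sqnormc _) => c d e f e0 d0 c0.
by field; rewrite c0 d0 e0.
Qed.

Lemma rot_hproj a b u : (a, b) != 0 -> u != 0 ->
  rot a b (hproj u) = hproj (rotv a b u).
Proof.
move=> ab u0; apply/hproj_eq; rewrite ?rotv_neq0 ?hlift_neq0//.
rewrite wedge_rotv (_ : wedge _ u = 0) ?mulr0//.
by apply/hproj_eq; rewrite ?hlift_neq0 ?hliftK.
Qed.

Lemma rotK a b p : (a, b) != 0 -> rot (conjc a) (- b) (rot a b p) = p.
Proof.
move=> ab; have ab' := conj_pair_neq0 ab.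
rewrite {2}/rot rot_hproj ?rotv_neq0 ?hlift_neq0// -[RHS]hliftK.
apply/hproj_eq; rewrite ?rotv_neq0 ?hlift_neq0//.
by rewrite /rotv /wedge /= rmorphN /= conjcK; ring.
Qed.

Lemma rot_from_zero w : exists a b, (a, b) != 0 /\ rot a b (Some 0) = w.
Proof.
exists (conjc (hlift w).2), (hlift w).1; split.
  by rewrite -sqn_eq0 /sqn /= sqnormc_conjc addrC -/(sqn _) sqn_eq0 hlift_neq0.
rewrite /rot /rotv /= conjcK !mulr0 !mulr1 add0r subr0.
by rewrite -[RHS]hliftK; case: (hlift w).
Qed.

Lemma rot_to_infty w : exists a b, (a, b) != 0 /\ rot a b w = None.
Proof.
exists (conjc (hlift w).1), (conjc (hlift w).2); split.
  by rewrite -sqn_eq0 /sqn /= !sqnormc_conjc -/(sqn _) sqn_eq0 hlift_neq0.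
by rewrite /rot /rotv /hproj /= !conjcK mulrC subrr eqxx.
Qed.

Lemma sqchord_fin z z' : sqchord (Some z) (Some z') =
  sqnormc (z - z') / ((1 + sqnormc z) * (1 + sqnormc z')).
Proof.
by rewrite /sqchord /wedge /sqn /= mulr1 mul1r sqnormc1 !(addrC _ 1).
Qed.

Lemma sqchord_fin0 z : sqchord (Some z) (Some 0) = sqnormc z / (1 + sqnormc z).
Proof. by rewrite sqchord_fin subr0 sqnormc0 addr0 mulr1. Qed.

End Rotations.

Section RationalCompositions.
Context {R : realType}.
Implicit Types (a b z : R[i]) (p g : Chat R -> Chat R) (w x y : Chat R).

Inductive ratcomp : (Chat R -> Chat R) -> Prop :=
| ratcomp_id : ratcomp id
| ratcomp_comp g p : Defs.Rat g -> ratcomp p -> ratcomp (g \o p).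

Lemma ratcomp_affine p a b : ratcomp p -> (a, b) != 0 ->
  exists A B : {poly R[i]}, forall z, (A.[z], B.[z]) != 0 /\
    p (rot a b (Some z)) = hproj (A.[z], B.[z]).
Proof.
move=> hp ab; elim: hp => [|g q gR _ [A [B AB]]].
  exists (a *: 'X + b%:P), ((conjc a)%:P - conjc b *: 'X) => z.
  have E : ((a *: 'X + b%:P).[z], ((conjc a)%:P - conjc b *: 'X).[z]) =
      rotv a b (z, 1).
    by rewrite /rotv /= !hornerE.
  by rewrite E; split=> //; exact: (rotv_neq0 ab (hlift_neq0 (Some z))).
have [d [P [Q [_ _ gE]]]] := Rat_hlifts gR.
pose H (F : {poly R[i]}) := \sum_(k < d.+1) F`_k *: (A ^+ k * B ^+ (d - k)).
have HE F z : (H F).[z] = hev d F (A.[z], B.[z]).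
  rewrite /H horner_sum; apply: eq_bigr => k _.
  by rewrite hornerZ hornerM !horner_exp mulrA.
exists (H P), (H Q) => z; have [n0 e] := AB z.
by rewrite /= e !HE; exact: gE.
Qed.

(** As [sqchord] is a squared distance, [e] bounds the square of the spherical
    derivative from below.  No chart is involved, so the notion is invariant under
    rotations. *)
Definition expands_at p w (e : R) := exists2 rho, 0 < rho &
  forall x, sqchord x w < rho -> e * sqchord x w <= sqchord (p x) (p w).

(** Rotations bring [w] to the origin and [x0] to infinity, where [p] becomes a
    quotient of polynomials bounded on a disc and [affine_distortion] applies.
    Neither [K] nor [rho] depends on [p], in particular not on its degree: this is
    what allows words of arbitrary length. *)
Lemma distortion (s r : R) : 0 < s -> 0 < r -> exists K rho : R, 0 < rho /\
  forall p w x0 e, ratcomp p -> 4 <= e ->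
    (forall x, sqchord x w < s -> r <= sqchord (p x) x0) ->
    expands_at p w e ->
    e <= K /\
    forall x, sqchord x w < rho ->
      e / 64 * sqchord x w <= sqchord (p x) (p w).
Proof.
move=> s0 r0; pose S := Num.min s 1; pose M := r^-1.
have S0 : 0 < S by rewrite lt_min s0 ltr01.
have Ss : S <= s by rewrite ge_min lexx.
have M0 : 0 <= M by rewrite invr_ge0 ltW.
pose K1 := 256 * M / S; pose K2 := 256 * K1 / S.
have K10 : 0 <= K1 := divr_ge0 (mulr_ge0 (ler0n _ 256) M0) (ltW S0).
have K20 : 0 <= K2 := divr_ge0 (mulr_ge0 (ler0n _ 256) K10) (ltW S0).
pose rho := Num.min (Num.min (1 / 2) (S / 4))
  (Num.min (1 / (8 * (K2 + 1))) (1 / (2 * (K1 + 1)))).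
have rho0 : 0 < rho by rewrite !lt_min !divr_gt0 ?mulr_gt0 ?ltr_wpDl.
exists (4 * K1), rho; split=> // p w x0 e hp e4 far [rho' rho'0 exp].
have [a [b [ab abw]]] := rot_from_zero w.
have [c [d [cd cdx]]] := rot_to_infty x0.
have [A' [B' AB']] := ratcomp_affine hp ab.
pose A := c *: A' + d *: B'; pose B := conjc c *: B' - conjc d *: A'.
pose P z := p (rot a b (Some z)).
have ABE z : (A.[z], B.[z]) = rotv c d (A'.[z], B'.[z]).
  by rewrite /rotv /= !hornerE.
have AB0 z : (A.[z], B.[z]) != 0.
  by rewrite ABE rotv_neq0// (AB' z).1.
have PE z : rot c d (P z) = hproj (A.[z], B.[z]).
  have [n0 e'] := AB' z; rewrite /P e' rot_hproj//.
  by rewrite ABE.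
have zw z : sqchord (rot a b (Some z)) w = sqnormc z / (1 + sqnormc z).
  by rewrite -abw sqchord_rot// sqchord_fin0.
have pos z : 0 < 1 + sqnormc z by rewrite ltr_pwDl// sqnormc_ge0.
have zw_le z : sqchord (rot a b (Some z)) w <= sqnormc z.
  by rewrite zw ler_pdivrMr// ler_peMr ?sqnormc_ge0// lerDl sqnormc_ge0.
have bound z : sqnormc z < S -> r * (sqnormc A.[z] + sqnormc B.[z]) <= sqnormc B.[z].
  move=> zS; have := far (rot a b (Some z)).
  rewrite (le_lt_trans (zw_le z))//; last exact: lt_le_trans zS Ss.
  move=> /(_ isT); rewrite -(sqchord_rot _ _ cd) -/(P z) PE cdx.
  have -> : None = hproj (1, 0) :> Chat R by rewrite /hproj /= eqxx.
  rewrite sqchordE ?AB0 ?(hlift_neq0 None)//.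
  rewrite /sqn /wedge /= mulr0 mulr1 sub0r sqnormcN sqnormc1 sqnormc0 addr0 mulr1.
  by rewrite ler_pdivlMr//; have := AB0 z; rewrite -sqn_gt0.
have B0 z : sqnormc z < S -> B.[z] != 0.
  move=> /bound; have := AB0 z; rewrite -sqn_gt0 /sqn /= => h1 h2.
  by rewrite -sqnormc_gt0 (lt_le_trans _ h2)// mulr_gt0.
have ABM z : sqnormc z < S -> sqnormc A.[z] <= M * sqnormc B.[z].
  move=> /bound h; rewrite /M mulrC ler_pdivlMr// mulrC (le_trans _ h)//.
  by rewrite ler_wpM2l ?(ltW r0)// lerDl sqnormc_ge0.
pose f z := A.[z] / B.[z].
have Pf z : sqnormc z < S -> rot c d (P z) = Some (f z).
  by move=> /B0 zB; rewrite PE /hproj /= (negbTE zB).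
have z0S : sqnormc (0 : R[i]) < S by rewrite sqnormc0.
have chordP z : sqnormc z < S -> sqchord (p (rot a b (Some z))) (p w) =
    sqnormc (f z - f 0) / ((1 + sqnormc (f z)) * (1 + sqnormc (f 0))).
  move=> zS; rewrite -[in p w]abw -/(P z) -/(P 0) -(sqchord_rot _ _ cd) !Pf//.
  by rewrite sqchord_fin.
have conv z (k : R) : sqnormc z < S ->
    (k * sqchord (rot a b (Some z)) w <= sqchord (p (rot a b (Some z))) (p w)) =
    (k * sqnormc z * ((1 + sqnormc (f z)) * (1 + sqnormc (f 0))) <=
     sqnormc (f z - f 0) * (1 + sqnormc z)).
  move=> zS; rewrite chordP// zw ler_pdivlMr ?mulr_gt0//.
  by rewrite mulrA mulrAC ler_pdivrMr.
have r'S0 : 0 < Num.min rho' S by rewrite lt_min rho'0 S0.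
have [|eK low] := affine_distortion S0 M0 e4 r'S0 B0 ABM.
  move=> z; rewrite lt_min => /andP[zr zS]; rewrite -/(f z) -/(f 0) -conv//.
  by apply: exp; exact: le_lt_trans (zw_le z) zr.
split=> // x xw.
have [z xz] : exists z, x = rot a b (Some z).
  have xK : rot a b (rot (conjc a) (- b) x) = x.
    by have := rotK x (conj_pair_neq0 ab); rewrite conjcK opprK.
  case E : (rot (conjc a) (- b) x) xK => [z|] xK; first by exists z.
  have := xw; rewrite -xK -abw sqchord_rot//.
  rewrite /sqchord /wedge /sqn /= mulr1 mulr0 subr0 !sqnormc1 !sqnormc0.
  rewrite addr0 add0r mulr1 divr1.
  by rewrite /rho !lt_min => /andP[/andP[+ _] _]; lra.
rewrite xz in xw *.
move: xw; rewrite /rho !lt_min => /andP[/andP[h1 h2] /andP[h3 h4]].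
have zD : sqnormc z <= 2 * sqchord (rot a b (Some z)) w.
  have : sqchord (rot a b (Some z)) w * (1 + sqnormc z) = sqnormc z.
    by rewrite zw divfK// gt_eqF.
  have := ler_wpM2r (sqnormc_ge0 z) (ltW h1); lra.
have zS : sqnormc z < S by lra.
rewrite conv//; apply: low => //.
  move: h3; rewrite ltr_pdivlMr ?mulr_gt0 ?ltr_wpDl// => h3.
  rewrite -/K1 -/K2.
  have := ler_wpM2r K20 zD; have := sqchord_ge0 (rot a b (Some z)) w; nra.
move: h4; rewrite ltr_pdivlMr ?mulr_gt0 ?ltr_wpDl// => h4.
rewrite -/K1; have := ler_wpM2r K10 zD.
have := sqchord_ge0 (rot a b (Some z)) w; nra.
Qed.

End RationalCompositions.

(** * The spherical derivative as a metric expansion rate *)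

Section SphericalDerivative.
Context {R : realType}.
Implicit Types (a p q : Chat R) (g : Chat R -> Chat R) (z t l : R[i]).

Lemma normc_sqr z : Normc.normc z ^+ 2 = sqnormc z.
Proof. by case: z => x y; rewrite sqr_sqrtr// addr_ge0 ?sqr_ge0. Qed.

Lemma normc_ge0 z : 0 <= Normc.normc z.
Proof. by case: z => x y; exact: sqrtr_ge0. Qed.

Lemma normc_lt z (e : R) : 0 <= e -> (`|z| < e%:C) = (sqnormc z < e ^+ 2).
Proof.
move=> e0; have -> : `|z| = (Normc.normc z)%:C by [].
by rewrite ltcR -normc_sqr ltr_pXn2r// nnegrE// normc_ge0.
Qed.

(** The limit in the definition of the derivative, when it is not zero, is a
    genuine one, a diverging filter having limit [0] by convention. *)
Lemma derive1_cvg (h : R[i]^o -> R[i]^o) (w : R[i]) : derive1 h w != 0 ->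
  forall e : R, 0 < e -> exists2 d : R, 0 < d &
    forall t, t != 0 -> sqnormc t < d ->
      sqnormc (derive1 h w - t^-1 * (h (t + w) - h w)) < e.
Proof.
move=> l0 e e0.
have hc : (fun t : R[i]^o => t^-1 *: (h (t + w) - h w)) @ 0^' --> derive1 h w.
  apply: contrapT => /dvgP h0; move/eqP: l0; apply; exact: h0.
have se0 : 0 < Num.sqrt e by rewrite sqrtr_gt0.
have /cvgrPdist_lt /(_ (Num.sqrt e)%:C) := hc.
rewrite ltcR => /(_ se0) [d /= d0 hd].
have dE : d = (complex.Re d)%:C.
  by move: d0; rewrite ltcE /= => /andP[/eqP i0 _]; case: d i0 {hd} => x y /= ->.
have d1 : 0 < complex.Re d by move: d0; rewrite ltcE /= => /andP[].
exists (complex.Re d ^+ 2); first by rewrite exprn_gt0.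
move=> t t0 td; have := hd t; rewrite /ball /= sub0r normrN dE.
rewrite normc_lt ?(ltW d1)// => /(_ td t0).
by rewrite normc_lt ?(ltW se0)// sqr_sqrtr// ltW.
Qed.

Definition chart_excluded a : Chat R := if a is Some _ then None else Some 0.

Lemma chart_excluded_neq a : a != chart_excluded a.
Proof. by case: a. Qed.

Lemma chartK a q : q != chart_excluded a -> chart_inv a (chart a q) = q.
Proof.
case: a q => [x|] [y|] //=; last by rewrite eqxx.
by rewrite -[Some y == _]/(y == 0) => y0; rewrite invr_eq0 (negbTE y0) invrK.
Qed.

Lemma sqchord_chart a q q' : q != chart_excluded a -> q' != chart_excluded a ->
  sqchord q q' = sqnormc (chart a q - chart a q') /
    ((1 + sqnormc (chart a q)) * (1 + sqnormc (chart a q'))).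
Proof.
case: a => [x|] /=.
  by case: q q' => [y|] [y'|] //= _ _; rewrite sqchord_fin.
have E y : y != Some 0 -> y = hproj (1, chart None y).
  case: y => [y|] //=; last by rewrite /hproj /= eqxx.
  rewrite -[Some y == _]/(y == 0) => y0.
  by rewrite /hproj /= invr_eq0 (negbTE y0) div1r invrK.
have n0 (y : R[i]) : (1, y) != (0, 0) :> R[i] * R[i].
  by rewrite -[(0, 0)]/(0 : R[i] * R[i]) -sqn_eq0 /sqn /= sqnormc1 gt_eqF// ltr_pwDl// sqnormc_ge0.
move=> /E eq /E eq'; rewrite {1}eq {1}eq' sqchordE//.
by rewrite /wedge /sqn /= mul1r mulr1 sqnormc1 -sqnormcN opprB.
Qed.

Lemma sqchord_neq a p : p != a ->
  exists2 d, 0 < d & forall q, sqchord q p < d -> q != a.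
Proof.
move=> pa; exists (sqchord a p).
  rewrite lt_def sqchord_ge0 andbT.
  by apply: contra pa => /eqP /sqchord_eq0 ->.
by move=> q; apply: contraTneq => ->; rewrite ltxx.
Qed.

(** In the charts the spherical distances differ from the Euclidean ones by factors
    [1 + |w| ^ 2]; the factor 64 covers their variation near the point, and that of
    the difference quotient. *)
Lemma sph_deriv_expands g p (L c e : R) :
  (forall q, sqchord (g q) (g p) <= L * sqchord q p) ->
  0 < c -> c <= sph_deriv_norm g p -> 0 <= e -> 64 * e <= c ^+ 2 ->
  expands_at g p e.
Proof.
pose h : R[i]^o -> R[i]^o := fun v => chart (g p) (g (chart_inv p v)).
pose w : R[i] := chart p p; pose l : R[i] := derive1 h w.
move=> gL c0; rewrite /sph_deriv_norm -/h -/w -/l => cl e0 ec.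
have W1 : 1 <= 1 + sqnormc w by rewrite lerDl sqnormc_ge0.
have H1 : 1 <= 1 + sqnormc (h w) by rewrite lerDl sqnormc_ge0.
set W := 1 + sqnormc w in cl W1; set H := 1 + sqnormc (h w) in cl H1.
have H0 : 0 < H := lt_le_trans ltr01 H1.
have W0 : 0 < W := lt_le_trans ltr01 W1.
have l0 : l != 0.
  apply: contraTneq cl => ->; rewrite -ltNge.
  by rewrite (_ : Normc.normc 0 = 0) ?mul0r ?mul0r// Normc.normc0.
have La0 : 0 < sqnormc l by rewrite sqnormc_gt0.
have cl2 : c ^+ 2 * H ^+ 2 <= sqnormc l * W ^+ 2.
  have cH : c * H <= Normc.normc l * W by rewrite -ler_pdivlMr.
  have cH0 : 0 <= c * H by rewrite mulr_ge0 ?ltW.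
  by rewrite -normc_sqr -!exprMn lerXn2r// nnegrE// (le_trans cH0 cH).
have [d d0 hd] := derive1_cvg l0 (divr_gt0 La0 (ltr0n _ 4)).
have [d1 d10 hd1] := sqchord_neq (chart_excluded_neq p).
have [d2 d20 hd2] := sqchord_neq (chart_excluded_neq (g p)).
have L0 : 0 < `|L| + 1 by rewrite ltr_wpDl.
pose T := Num.min d (Num.min (1 / 4) (1 / (4 * sqnormc l))).
have T0 : 0 < T by rewrite !lt_min d0 !divr_gt0// mulr_gt0.
pose rho := Num.min (Num.min d1 (d2 / (`|L| + 1)))
    (Num.min (1 / (4 * W)) (T / (4 * W ^+ 2))).
exists rho; rewrite /rho.
  by rewrite !lt_min d10 !divr_gt0// mulr_gt0// exprn_gt0.
move=> q; rewrite !lt_min => /andP[/andP[q1 q2] /andP[q3 q4]].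
have [->|qp] := eqVneq q p; first by rewrite !sqchordxx mulr0.
have qe := hd1 q q1; have pe := chart_excluded_neq p.
have gqe : g q != chart_excluded (g p).
  apply: hd2; apply: le_lt_trans (gL q) _.
  apply: (@le_lt_trans _ _ ((`|L| + 1) * sqchord q p)).
    by rewrite ler_wpM2r ?sqchord_ge0// (le_trans (ler_norm _))// lerDl.
  by rewrite mulrC -ltr_pdivlMr.
pose t := chart p q - w.
have tw : t + w = chart p q by rewrite /t subrK.
have hwE : h w = chart (g p) (g p) by rewrite /h /w chartK.
have htE : h (t + w) = chart (g p) (g q) by rewrite tw /h chartK.
have D1 := sqchord_chart qe pe.
have D2 := sqchord_chart gqe (chart_excluded_neq (g p)).
rewrite -htE -hwE -/H in D2; rewrite -/w -/t -tw -/W in D1.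
have tpos z : 0 < 1 + sqnormc z by rewrite ltr_pwDl// sqnormc_ge0.
have t0 : t != 0.
  apply: contra qp => /eqP te; apply/eqP.
  by rewrite -(chartK qe) -tw te add0r /w chartK.
have tD : sqnormc t = sqchord q p * ((1 + sqnormc (t + w)) * W).
  by rewrite D1 divfK// gt_eqF// mulr_gt0.
have D0 := sqchord_ge0 q p.
set D := sqchord q p in q3 q4 tD D0 *.
have tT : sqnormc t < T.
  have tw2 : 1 + sqnormc (t + w) <= 2 * W + 2 * sqnormc t.
    by have := sqnormcD_le t w; rewrite /W; lra.
  have h1 : sqnormc t <= D * W * (2 * W + 2 * sqnormc t).
    by rewrite {1}tD mulrA mulrAC ler_wpM2l// mulr_ge0// ltW.
  move: q3; rewrite ltr_pdivlMr ?mulr_gt0// => q3.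
  move: q4; rewrite ltr_pdivlMr ?mulr_gt0 ?exprn_gt0// => q4.
  have h2 : D * W * sqnormc t <= 1 / 4 * sqnormc t.
    by rewrite ler_wpM2r ?sqnormc_ge0//; lra.
  lra.
move: tT; rewrite !lt_min => /andP[td /andP[t1]].
rewrite ltr_pdivlMr ?mulr_gt0// => t2.
have := hd t t0 td; set k := t^-1 * _ => kl.
have kE : h (t + w) - h w = t * k by rewrite /k mulVKf.
rewrite D2 /D D1 kE sqnormcM.
have k1 : sqnormc l / 4 <= sqnormc k.
  by have := sqnormc_le_diff l k; lra.
have k2 : sqnormc k <= 4 * sqnormc l.
  by have := sqnormc_le_diff k l; rewrite -(sqnormcN (k - l)) opprB; lra.
have tw1 : W / 4 <= 1 + sqnormc (t + w).
  have := sqnormc_le_diff w (- t); rewrite opprK sqnormcN (addrC w).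
  by have := sqnormc_ge0 (t + w); rewrite /W; lra.
have hk1 : 1 + sqnormc (h (t + w)) <= 4 * H.
  rewrite -[h (t + w)](subrK (h w)) kE.
  have := sqnormcD_le (t * k) (h w); rewrite sqnormcM.
  have : sqnormc t * sqnormc k <= sqnormc t * (4 * sqnormc l).
    by rewrite ler_wpM2l// sqnormc_ge0.
  by have := sqnormc_ge0 (h w); rewrite /H; lra.
have tp := tpos (t + w); have hp := tpos (h (t + w)).
move: (sqnormc t) (sqnormc_ge0 t) {t1 t2 tD} => y y0.
move: (sqnormc k) (1 + sqnormc (t + w)) (1 + sqnormc (h (t + w)))
  k1 tw1 hk1 tp hp => K X Y k1 tw1 hk1 X0 Y0.
rewrite mulrA ler_pdivrMr ?mulr_gt0// mulrAC ler_pdivlMr ?mulr_gt0//.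
have -> : e * y * (Y * H) = y * (e * (Y * H)) by ring.
have -> : y * K * (X * W) = y * (K * (X * W)) by ring.
apply: ler_wpM2l => //.
apply: (@le_trans _ _ (e * (4 * H * H))).
  by rewrite ler_wpM2l// ler_wpM2r// ltW.
apply: (@le_trans _ _ (sqnormc l / 4 * (W / 4 * W))); last first.
  apply: ler_pM => //; rewrite ?divr_ge0 ?mulr_ge0 ?divr_ge0 ?sqnormc_ge0 ?(ltW W0)//.
  by rewrite ler_wpM2r// ltW.
have := ler_wpM2r (sqr_ge0 H) ec; lra.
Qed.

End SphericalDerivative.

(** * Cylinders in the shift space *)

Section Cylinders.
Context {R : realType} (S : rationalGDMS R).
Implicit Types (xi eta : shift_space S) (m n : nat).

Lemma ptws_cylinder (L : finType) m
    (x : {ptws nat -> discrete_topology L}) :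
  nbhs x [set y | forall n, (n < m)%N -> y n = x n].
Proof.
have FF : Filter (nbhs x) := nbhs_filter x.
elim: m => [|m IH].
  by apply: filterE => y n; rewrite ltn0.
have hm : nbhs x [set y | y m = x m].
  have := @proj_continuous nat (fun=> discrete_topology L) m x.
  move=> /(_ [set x m]); apply.
  by apply: open_nbhs_nbhs; split => //; exact: discrete_open.
apply: filterS (filterI IH hm) => y [y1 y2] n.
by rewrite ltnS leq_eqVlt => /predU1P[->//|/y1].
Qed.

(** Cylinders generate a filter which converges to [x] coordinatewise, hence in the
    product topology. *)
Lemma nbhs_ptws (L : finType) (x : {ptws nat -> discrete_topology L})
    (A : set {ptws nat -> discrete_topology L}) : nbhs x A ->
  exists m, forall y, (forall n, (n < m)%N -> y n = x n) -> A y.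
Proof.
pose F : set_system {ptws nat -> discrete_topology L} :=
  [set B | exists m, forall y, (forall n, (n < m)%N -> y n = x n) -> B y].
have FF : Filter F.
  split.
  - by exists 0%N.
  - move=> B C [m hm] [k hk]; exists (maxn m k) => y hy; split.
      by apply: hm => n nm; apply: hy; rewrite leq_max nm.
    by apply: hk => n nk; apply: hy; rewrite leq_max nk orbT.
  - by move=> B C BC [m hm]; exists m => y /hm /BC.
suff : F --> x by apply.
apply/cvg_sup => i B; rewrite nbhsE => -[C [[D oD <-] Dx] CB].
exists i.+1 => y hy; apply: CB => /=; move: Dx => /=.
by rewrite -(hy i).
Qed.

Lemma cylinder_nbhs xi m :
  nbhs xi [set eta | forall n, (n < m)%N -> letter_at eta n = letter_at xi n].
Proof.
have := @initial_continuous (shift_space S) _ (@set_val _ (@shift_seqs R S)) xi.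
by move=> /(_ _ (ptws_cylinder m (set_val xi))).
Qed.

Lemma nbhs_cylinder xi (A : set (shift_space S)) : nbhs xi A ->
  exists m, forall eta,
    (forall n, (n < m)%N -> letter_at eta n = letter_at xi n) -> A eta.
Proof.
rewrite nbhsE => -[B [[C oC <-] Cxi] BA].
have /nbhs_ptws[m hm] : nbhs (set_val xi) C.
  by apply: open_nbhs_nbhs; split.
by exists m => eta he; apply: BA; exact: hm.
Qed.

End Cylinders.

(** * Dynamics of the skew product and invariance of its Julia set *)

Section SymbolicDynamics.
Context {R : realType} (S : rationalGDMS R).
Implicit Types (xi eta zeta om : shift_space S) (m n k : nat) (a b : letter S).
Implicit Types (x y z : Chat R).

Lemma shift_space_ext xi eta :
  (forall n, letter_at xi n = letter_at eta n) -> xi = eta.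
Proof. by move=> h; apply: val_inj; apply/funext. Qed.

Lemma letter_at_iter xi m n :
  letter_at (iter m (@Defs.shift R S) xi) n = letter_at xi (m + n).
Proof.
elim: m n => [//|m IH] n; rewrite iterS.
by rewrite -[LHS]/(letter_at (iter m (@Defs.shift R S) xi) n.+1) IH addnS.
Qed.

Lemma prepend a xi : admissible a (letter_at xi 0) ->
  exists om, letter_at om 0 = a /\ Defs.shift om = xi.
Proof.
move=> ax; pose f n := if n is k.+1 then letter_at xi k else a.
have fP : (f : {ptws nat -> discrete_topology (letter S)}) \in @shift_seqs R S.
  by apply/mem_set => -[|n] //=; exact: (set_mem (valP xi)).
exists (exist _ (f : {ptws nat -> discrete_topology (letter S)}) fP).
by split=> //; exact: shift_space_ext.
Qed.

Lemma splice xi eta m : letter_at xi m = letter_at eta 0 ->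
  exists om, (forall n, (n <= m)%N -> letter_at om n = letter_at xi n) /\
    iter m (@Defs.shift R S) om = eta.
Proof.
elim: m xi => [|m IH] xi e.
  by exists eta; split=> // n; rewrite leqn0 => /eqP ->.
have [om [h1 h2]] := IH (Defs.shift xi) e.
have adm : admissible (letter_at xi 0) (letter_at om 0).
  by rewrite h1//; exact: (set_mem (valP xi)).
have [om' [h0 h]] := prepend adm; exists om'; split.
  by move=> [_|n nm]; rewrite ?h0// -[LHS]/(letter_at (Defs.shift om') n) h h1.
by rewrite iterSr h.
Qed.

(** A nonzero entry of a power of the transition matrix is a sum of products along
    paths, so one of these paths is admissible. *)
Lemma connect N zeta a :
  (forall i j, 0 < (transition_matrix S ^+ N) i j) ->
  exists eta, letter_at eta 0 = a /\ iter N (@Defs.shift R S) eta = zeta.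
Proof.
move=> pos; suff main i j xi : (transition_matrix S ^+ N) i j != 0 ->
    letter_at xi 0 = enum_val j ->
    exists eta, letter_at eta 0 = enum_val i /\ iter N (@Defs.shift R S) eta = xi.
  have [|eta [h1 h2]] := main (enum_rank a) (enum_rank (letter_at zeta 0)) zeta
    (lt0r_neq0 (pos _ _)).
    by rewrite enum_rankK.
  by exists eta; rewrite h1 enum_rankK.
elim: N {pos} i j xi => [|N IH] i j xi.
  by rewrite expr0 mxE; case: (i =P j) => [->|] // _ e; exists xi.
rewrite exprS mxE => h e.
have [k hk] : exists k : 'I_#|letter S|,
    transition_matrix S i k * (transition_matrix S ^+ N) k j != 0.
  apply: contrapT => /forallNP hn; move/eqP: h; apply.
  by apply: big1 => k _; apply/eqP; apply/negPn/negP; exact: hn.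
move: hk; rewrite mulf_eq0 negb_or => /andP[ik kj].
have [eta [e1 e2]] := IH k j xi kj e.
have adm : admissible (enum_val i) (letter_at eta 0).
  by rewrite e1; move: ik; rewrite mxE; case: admissible; rewrite ?eqxx.
by have [om [h1 h2]] := prepend adm; exists om; rewrite iterSr h2.
Qed.

Lemma fiber_mapS xi n :
  fiber_map xi n.+1 = lmap (letter_at xi n) \o fiber_map xi n.
Proof. by rewrite /fiber_map /word_map /mkseq -addn1 iotaD map_cat foldl_cat. Qed.

Lemma fiber_mapD xi m n :
  fiber_map xi (m + n) = fiber_map (iter m (@Defs.shift R S) xi) n \o fiber_map xi m.
Proof.
elim: n => [|n IH]; first by rewrite addn0.
by rewrite addnS !fiber_mapS IH letter_at_iter.
Qed.

Lemma fiber_mapSl xi n :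
  fiber_map xi n.+1 = fiber_map (Defs.shift xi) n \o lmap (letter_at xi 0).
Proof. by rewrite -add1n fiber_mapD. Qed.

Lemma fiber_map_ext xi eta n :
  (forall k, (k < n)%N -> letter_at xi k = letter_at eta k) ->
  fiber_map xi n = fiber_map eta n.
Proof.
elim: n => [//|n IH] h; rewrite !fiber_mapS h// IH// => k kn.
by apply: h; exact: ltnW.
Qed.

Lemma iter_skew_product n xi z :
  iter n (skew_product S) (xi, z) = (iter n (@Defs.shift R S) xi, fiber_map xi n z).
Proof.
elim: n => [//|n IH]; rewrite !iterS IH /skew_product /= fiber_mapS.
by rewrite letter_at_iter addn0.
Qed.

Lemma lmap_Rat a : Defs.Rat (lmap a).
Proof. by apply: (@maps_Rat R S (ledge a)); exact: finmap.fsvalP. Qed.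

Lemma fiber_ratcomp xi n : ratcomp (fiber_map xi n).
Proof.
elim: n => [|n IH]; first exact: ratcomp_id.
by rewrite fiber_mapS; exact: ratcomp_comp (lmap_Rat _) IH.
Qed.

Lemma fiber_surj xi n y : exists x, fiber_map xi n x = y.
Proof.
elim: n y => [|n IH] y; first by exists y.
have [x' e] := Rat_surj y (lmap_Rat (letter_at xi n)).
by have [x e'] := IH x'; exists x; rewrite fiber_mapS /= e'.
Qed.

Lemma letters_lipschitz : exists2 L : R, 0 < L &
  forall a x y, sqchord (lmap a x) (lmap a y) <= L * sqchord x y.
Proof.
have /choice[f hf] : forall a, exists L : R, 0 < L /\
    forall x y, sqchord (lmap a x) (lmap a y) <= L * sqchord x y.
  by move=> a; have [L L0 h] := Rat_lipschitz (lmap_Rat a); exists L.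
have [k k0 hk] := @seq_pos_lower_bound _ _ (fun a => (f a)^-1)
  (enum {: letter S}) (fun a _ => eq_ind_r is_true (hf a).1 (invr_gt0 (f a))).
exists k^-1; first by rewrite invr_gt0.
move=> a x y; have [fa0 h] := hf a; apply: le_trans (h x y) _.
rewrite ler_wpM2r ?sqchord_ge0// -[f a]invrK lef_pV2 ?posrE ?invr_gt0//.
by apply: hk; rewrite mem_enum.
Qed.

Lemma letters_open (r : R) : 0 < r -> exists2 e : R, 0 < e & forall a x y,
  sqchord (lmap a x) y < e -> exists2 x', lmap a x' = y & sqchord x x' < r.
Proof.
move=> r0; have /choice[f hf] : forall a, exists e : R, 0 < e /\ forall x y,
    sqchord (lmap a x) y < e -> exists2 x', lmap a x' = y & sqchord x x' < r.
  by move=> a; have [e e0 h] := Rat_open (lmap_Rat a) r0; exists e.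
have [k k0 hk] := @seq_pos_lower_bound _ _ f (enum {: letter S})
  (fun a _ => (hf a).1).
exists k => // a x y h; have [_] := hf a; apply.
by apply: lt_le_trans h _; apply: hk; rewrite mem_enum.
Qed.

Lemma fiber_lipschitz n : exists2 L : R, 0 < L & forall xi x y,
  sqchord (fiber_map xi n x) (fiber_map xi n y) <= L * sqchord x y.
Proof.
have [L L0 hL] := letters_lipschitz.
elim: n => [|n [M M0 hM]]; first by exists 1 => // xi x y; rewrite mul1r.
exists (L * M) => [|xi x y]; first by rewrite mulr_gt0.
rewrite fiber_mapS /= -mulrA; apply: le_trans (hL _ _ _) _.
by rewrite ler_wpM2l ?(ltW L0).
Qed.

Lemma fiber_open n (r : R) : 0 < r -> exists2 e : R, 0 < e & forall xi x y,
  sqchord (fiber_map xi n x) y < e ->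
  exists2 x', fiber_map xi n x' = y & sqchord x x' < r.
Proof.
elim: n r => [|n IH] r r0; first by exists r => // xi x y h; exists y.
have [e e0 he] := IH r r0; have [d d0 hd] := letters_open e0.
exists d => // xi x y; rewrite fiber_mapS /= => /hd[x' <- /he[x'' <- h]].
by exists x''.
Qed.

End SymbolicDynamics.

Section JuliaSets.
Context {R : realType} (S : rationalGDMS R).
Implicit Types (xi eta zeta om : shift_space S) (m n k : nat).
Implicit Types (x y z : Chat R).

(** The first map is open: a point close to the image of [z] has a preimage close to
    [z], where the equicontinuity along [xi] can be used. *)
Lemma fiber_Fatou_image xi z : fiber_Fatou xi z ->
  fiber_Fatou (Defs.shift xi) (lmap (letter_at xi 0) z).
Proof.
set g := lmap _ => -[U /nbhs_interior/nbhs_sqchord[d d0 dU] eqU].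
have gR : Defs.Rat g := lmap_Rat _.
have [e e0 he] := Rat_open gR d0.
exists [set y | sqchord (g z) y < e]; first by apply/nbhs_sqchord; exists e.
set V := [set y | _] => y E entE.
pose G : set (Chat R -> Chat R) :=
  [set fiber_map (Defs.shift xi) n | n in [set n | (0 < n)%N]].
suff : nbhs_subspace (y : subspace V) [set y' | forall h, G h -> E (h y, h y')].
  by [].
have [yV|yV] := pselect (V y); last first.
  rewrite -(@nbhs_subspace_out (Chat R) V y yV) => _ -> h _; exact: entourage_refl.
suff : nbhs (y : Chat R) [set y' | forall h, G h -> E (h y, h y')].
  by rewrite -(@nbhs_subspace_in (Chat R) V y yV); apply: filterS => y' h _.
have [x gx /dU xU] := he _ _ yV.
have /nbhs_sqchord[d1 d10 h1] : nbhs (x : Chat R) [set x' | forall h,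
    [set fiber_map xi n | n in [set n | (0 < n)%N]] h -> E (h x, h x')].
  by rewrite (@nbhs_subspace_interior (Chat R) U x xU); exact: (eqU x E entE).
have [e1 e10 he1] := Rat_open gR d10.
apply/nbhs_sqchord; exists e1 => // y'; rewrite -gx => /he1[x' <- /h1 hx'] _ [n /= n0 <-].
have := hx' (fiber_map xi n.+1); rewrite fiber_mapSl; apply.
by exists n.+1 => //; rewrite fiber_mapSl.
Qed.

(** A Julia point near the image of [(om, x)] has a preimage near [(om, x)]: prepend
    the first letter of [om] and use that the corresponding map is open.  That
    preimage is a Julia point by the previous lemma. *)
Lemma skew_Julia_preimage om x :
  skew_Julia S (Defs.shift om, lmap (letter_at om 0) x) -> skew_Julia S (om, x).
Proof.
set g := lmap _ => J B [[B1 B2] [/= /nbhs_cylinder[m hm] /nbhs_sqchord[d d0 hd]] B12].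
have gR : Defs.Rat g := lmap_Rat _.
have [e e0 he] := Rat_open gR d0.
have := J ([set eta | forall n, (n < m.+1)%N ->
    letter_at eta n = letter_at (Defs.shift om) n] `*` [set y | sqchord (g x) y < e]).
case.
  exists ([set eta | forall n, (n < m.+1)%N ->
    letter_at eta n = letter_at (Defs.shift om) n], [set y | sqchord (g x) y < e]) => //=.
  split; first exact: cylinder_nbhs.
  by apply/nbhs_sqchord; exists e.
move=> [eta y] [[_ _ [/= <- Jy]] [/= etam /he[x' gx' xx']]].
have adm : admissible (letter_at om 0) (letter_at eta 0).
  by rewrite etam//; exact: (set_mem (valP om)).
have [om' [h0 h]] := prepend adm.
exists (om', x'); split.
  exists om' => //; split=> //= F'; apply: Jy.
  by have := fiber_Fatou_image F'; rewrite h h0 -/g gx'.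
apply: B12; split; last exact: hd.
apply: hm => -[//|n] nm.
by rewrite -[LHS]/(letter_at (Defs.shift om') n) h etam// ltnW// ltnS ltnW.
Qed.

Lemma skew_Julia_iter_preimage n om x :
  skew_Julia S (iter n (@Defs.shift R S) om, fiber_map om n x) ->
  skew_Julia S (om, x).
Proof.
elim: n om x => [//|n IH] om x; rewrite iterSr fiber_mapSl => /IH.
exact: skew_Julia_preimage.
Qed.

End JuliaSets.

(** * Expansion along blocks and topological exactness *)

Section Expansion.
Context {R : realType} (S : rationalGDMS R).
Implicit Types (xi eta zeta om : shift_space S) (m n k : nat).
Implicit Types (x y z : Chat R).

Lemma geometric_ge (C l K : R) : 0 < C -> 1 < l ->
  exists n0 : nat, forall n, (n0 <= n)%N -> K <= C * l ^+ n.
Proof.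
move=> C0 l1; have l0 : 0 < l := lt_trans ltr01 l1.
have q1 : 0 <= l^-1 < 1 by rewrite invr_ge0 ltW//= invf_lt1.
have e0 : 0 < C / (`|K| + 1) by rewrite divr_gt0// ltr_wpDl.
have [n0 h] := expr_eventually_lt q1 e0; exists n0 => n /h.
rewrite exprVn ltr_pdivlMr ?ltr_wpDl// mulrC ltr_pdivrMr ?exprn_gt0// => hK.
by have := ler_norm K; lra.
Qed.

Definition fiber_expansion (C l : R) : Prop := forall n : nat, (0 < n)%N ->
  ((C * l ^+ n)%:E <=
   ereal_inf [set (sph_deriv_norm (fiber_map z.1 n) z.2)%:E
             | z in skew_Julia S])%E.

Lemma Julia_expands (C l : R) om x n (e : R) : 0 < C -> 1 < l ->
  fiber_expansion C l -> skew_Julia S (om, x) -> (0 < n)%N ->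
  0 <= e -> 64 * e <= (C * l ^+ n) ^+ 2 -> expands_at (fiber_map om n) x e.
Proof.
move=> C0 l1 expanding J n0 e0 he; have [L _ hL] := fiber_lipschitz S n.
apply: (@sph_deriv_expands _ _ _ L (C * l ^+ n)) => //.
  by rewrite mulr_gt0// exprn_gt0// (lt_trans ltr01).
rewrite -lee_fin; apply: le_trans (expanding n n0) _.
by apply: ereal_inf_lbound; exists (om, x).
Qed.

(** The letters are Lipschitz, so a block of fixed length moves a small disc around
    a Julia point by little and omits a neighbourhood of [0] or of infinity there.
    Hence [distortion] applies with radii that do not depend on the point, and
    makes the pointwise expansion uniform. *)
Lemma block_expands (C l : R) : 0 < C -> 1 < l -> fiber_expansion C l ->
  exists n0 : nat, (0 < n0)%N /\
  exists2 rho : R, 0 < rho & forall om x x', skew_Julia S (om, x) ->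
    sqchord x' x < rho ->
    4 * sqchord x' x <= sqchord (fiber_map om n0 x') (fiber_map om n0 x).
Proof.
move=> C0 l1 expanding; have [n1 hn1] := geometric_ge 128 C0 l1.
pose n0 := n1.+1; exists n0; split=> //.
have X : 128 <= C * l ^+ n0 by apply: hn1; exact: leqnSn.
have [L L0 hL] := fiber_lipschitz S n0.
have s0 : 0 < 1 / (16 * L) by rewrite divr_gt0// mulr_gt0.
have r0 : 0 < 1 / 16 :> R by rewrite divr_gt0.
have [K [rho [rho0 dist]]] := distortion s0 r0.
exists rho => // om x x' J xx'.
have far : 1 / 4 <= Num.max (sqchord (fiber_map om n0 x) None)
    (sqchord (fiber_map om n0 x) (Some 0)).
  have := sqchord_far None (Some 0) (fiber_map om n0 x).
  have -> : sqchord None (Some 0) = 1 :> R.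
    rewrite /sqchord /wedge /sqn /= mulr1 mulr0 subr0 !sqnormc1 !sqnormc0.
    by rewrite addr0 add0r mulr1 divr1.
  lra.
have [w hw] : exists w, 1 / 4 <= sqchord (fiber_map om n0 x) w.
  by move: far; rewrite le_max => /orP[h|h]; [exists None|exists (Some 0)].
have e4 : 4 <= 256 :> R by lra.
have [|| _ low] := dist _ x w 256 (fiber_ratcomp om n0) e4.
- move=> v; rewrite ltr_pdivlMr ?mulr_gt0// => vx.
  have := hL om v x; have := sqchord_triangle (fiber_map om n0 v)
    (fiber_map om n0 x) w.
  rewrite (sqchord_sym (fiber_map om n0 x) (fiber_map om n0 v)); lra.
- apply: (Julia_expands C0 l1 expanding J); [by []|lra|rewrite expr2].
  have X0 : 0 <= 128 :> R by lra.
  by have := ler_pM X0 X0 X X; lra.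
by have := low x' xx'; lra.
Qed.

(** Going back one block at a time, openness yields a preimage of [x] nearby, which
    is again a Julia point, and the expansion there divides [sqchord] by 4. *)
Lemma pullback (n0 : nat) (rho : R) : 0 < rho ->
  (forall om x x', skew_Julia S (om, x) -> sqchord x' x < rho ->
    4 * sqchord x' x <= sqchord (fiber_map om n0 x') (fiber_map om n0 x)) ->
  exists2 r : R, 0 < r & forall k om x x' (t : R),
    skew_Julia S (iter (k * n0) (@Defs.shift R S) om, x) ->
    sqchord (fiber_map om (k * n0) x') x <= t -> t < r ->
    exists2 x1, fiber_map om (k * n0) x1 = x & sqchord x' x1 <= t * 4^-1 ^+ k.
Proof.
move=> rho0 hexp; have [r r0 hr] := fiber_open S n0 rho0.
exists r => //; elim=> [|k IH] om x x' t J h tr.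
  by exists x => //; rewrite expr0 mulr1.
move: J h; rewrite mulSnr fiber_mapD addnC iterD.
set om' := iter _ _ om; set u := fiber_map om (k * n0) x' => J h.
have [xb xbE uxb] := hr om' u x (le_lt_trans h tr).
have Jb : skew_Julia S (om', xb).
  by apply: (@skew_Julia_iter_preimage _ _ n0); rewrite xbE.
have := hexp om' xb u Jb uxb; rewrite xbE => h4.
have t4 : sqchord u xb <= t / 4.
  by rewrite ler_pdivlMr// mulrC (le_trans h4 h).
have t0 : 0 <= t by apply: le_trans h; exact: sqchord_ge0.
have [|x1 x1E hx1] := IH om xb x' (t / 4) Jb t4; first by lra.
exists x1; first by rewrite /= x1E.
by rewrite exprS mulrA.
Qed.

End Expansion.

Theorem mainTheorem2 (R : realType) (S : rationalGDMS R) :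
  non_elementary S -> irreducible_aperiodic S -> expanding_along_fibers S ->
  topologically_exact_on (skew_product S) (skew_Julia S).
Proof.
move=> _ [N0 [_ pos]] [C [l [C0 l1 expanding]]] U oU [[xi z] [Uz Jz]].
have [n0 [n00 [rho rho0 hexp]]] := block_expands C0 l1 expanding.
have [r r0 pb] := pullback rho0 hexp.
have : nbhs (xi, z) U by apply: open_nbhs_nbhs.
move=> [[B1 B2] [/= /nbhs_cylinder[m hm] /nbhs_sqchord[s s0 hs]] BU].
have s40 : 0 < s / 4 by rewrite divr_gt0.
have [K [? [_ dist]]] := distortion s40 r0.
(* [e] exceeds the bound that the Schwarz lemma allows. *)
pose e := Num.max 4 (K + 1).
have e4 : 4 <= e by rewrite le_max lexx.
have eK : K < e by rewrite lt_max ltrDl ltr01 orbT.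
have [n1 hn1] := geometric_ge (64 * e) C0 l1.
have q1 : 0 <= (4^-1 : R) < 1 by apply/andP; split; lra.
have [k1 hk1] := expr_eventually_lt q1 (divr_gt0 s40 r0).
have [k [mM n1M M0 qk]] : exists k,
    [/\ (m <= k * n0)%N, (n1 <= k * n0)%N, (0 < k * n0)%N &
        r * 4^-1 ^+ k < s / 4].
  pose k := (maxn (maxn m n1) k1).+1; exists k.
  have kM : (k <= k * n0)%N by rewrite leq_pmulr.
  split.
  - by apply: leq_trans kM; rewrite leqW// !leq_max leqnn.
  - by apply: leq_trans kM; rewrite leqW// !leq_max leqnn orbT.
  - exact: leq_trans kM.
  - by rewrite mulrC -ltr_pdivlMr// hk1// leqW// leq_max leqnn orbT.
pose M := (k * n0)%N; rewrite -/M in mM n1M M0.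
exists (M + N0).+1; split=> // n nN [zeta y] Jy.
(* [om] follows [xi] for [n - N0] letters and then a path of length [N0] to [zeta];
   the first [M] letters give the expanding map [p], the others a map onto the
   sphere carrying some [x] to [y]. *)
have N0n : (N0 <= n)%N := leq_trans (leq_addl M N0) (ltnW nN).
have Mn : (M <= n)%N := leq_trans (leq_addr N0 M) (ltnW nN).
have MnN0 : (M <= n - N0)%N by rewrite -(leq_add2r N0) subnK// ltnW.
have [eta [eta0 etaE]] := connect zeta (letter_at xi (n - N0)) pos.
have [om [omxi omE]] := splice (esym eta0).
have omn : iter n (@Defs.shift R S) om = zeta.
  by rewrite -etaE -omE -iterD subnKC.
pose om1 := iter M (@Defs.shift R S) om.
have [x xE] := fiber_surj om1 (n - M) y.
have Jx : skew_Julia S (om1, x).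
  apply: (@skew_Julia_iter_preimage _ _ (n - M)).
  by rewrite xE /om1 -iterD subnK// omn.
have pE : fiber_map om M = fiber_map xi M.
  by apply: fiber_map_ext => j jM; apply/omxi/ltnW/(leq_trans jM).
suff [x1 zx1 x1E] : exists2 x1, sqchord z x1 < s & fiber_map om M x1 = x.
  exists (om, x1).
    apply: BU; split; last exact: hs.
    by apply: hm => j jm; apply/omxi/ltnW/(leq_trans jm)/(leq_trans mM).
  have nE : n = (M + (n - M))%N by rewrite subnKC.
  by rewrite iter_skew_product omn {1}nE fiber_mapD /= x1E xE.
(* Otherwise [p] omits the disc [sqchord _ x < r] on a disc about [z], since by
   [pullback] a value close to [x] would come from near a preimage of [x]. *)
apply: contrapT => hn.
suff : e <= K by rewrite leNgt eK.
have [||//] := dist _ z x e (fiber_ratcomp om M) e4.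
  move=> x' x'z; rewrite leNgt; apply/negP => x'x.
  have [x1 x1E x'x1] := pb k om x x' _ Jx (lexx _) x'x.
  apply: hn; exists x1 => //.
  have := sqchord_triangle x' z x1; rewrite (sqchord_sym z x').
  have : sqchord (fiber_map om (k * n0) x') x * 4^-1 ^+ k <= r * 4^-1 ^+ k.
    by rewrite ler_wpM2r ?exprn_ge0 ?invr_ge0// ltW.
  lra.
rewrite pE; apply: (Julia_expands C0 l1 expanding) => //.
- lra.
have h := hn1 M n1M; apply: le_trans (h) _.
by rewrite expr2 ler_peMl//; lra.
Qed.
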